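(* Let $W$ be a tournament kernel on a probability space $(\mathcal S,\mu)$. Let $(\mathcal S_i)_{i\in\mathcal Q}$ ($\mathcal Q$ countable, possibly empty) be the atoms of $(\mathcal S,\sigma(\mathcal Z),\mu)$ and $\mathcal I=\mathcal S\setminus\bigcup_i\mathcal S_i$ its non-atomic part (possibly empty), and let $\eta$ be the map defined in the context. Then $\mathcal S=\mathcal I\sqcup\bigsqcup_{i\in\mathcal Q}\mathcal S_i$, $$\mu=\Big(1-\sum_{i\in\mathcal Q}\mu(\mathcal S_i)\Big)\mu_{\mathcal I}+\sum_{i\in\mathcal Q}\mu(\mathcal S_i)\mu_i,$$ and $W=\left(\bigoplus_{i\in\mathcal Q}\mu(\mathcal S_i)W_i,\mathcal I,\eta\right)$ (equality $\mu\times\mu$-a.e.), where the following hold (with the obvious modifications if $\mathcal Q$ or $\mathcal I$ is empty): (i) $\mu(\mathcal S_i)>0$ for each $i\in\mathcal Q$; (ii) $\mu_i(A)=\mu(A\cap\mathcal S_i)/\mu(\mathcal S_i)$ for measurable $A$; (iii) $\mu_{\mathcal I}$ is the probability measure induced by $\mu$ on $\mathcal I$, and it is non-atomic; (iv) $\eta|_{\mathcal Q}$ is injective, and $\eta|_{\mathcal I}$ is injective up to null sets and supported on $[0,1]\setminus\bigcup_{i\in\mathcal Q}[\eta(i),\eta(i)+\mu(\mathcal S_i))$; (v) for $i\in\mathcal Q$, $W_i=W|_{\mathcal S_i}$ on $(\mathcal S_i,\mu_i)$ is an irreducible tournament kernel; (vi) for every measurable $A\subseteq\mathcal I$ with $\mu_{\mathcal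 I}(A)>0$, the restriction $W|_A$ on $(A,\mu_{\mathcal I}(\cdot)/\mu_{\mathcal I}(A))$ is transitive.
   Context: A tournament kernel on a probability space $(\mathcal S,\mu)$ is a measurable $W:\mathcal S^2\to[0,1]$ with $W(x,y)+W(y,x)=1$ for $\mu\times\mu$-a.e. $(x,y)$. For measurable $A,B\subseteq\mathcal S$ with $\mu(A\cap B)=0$, write $A\prec B$ if $W(x,y)=1$ for a.e. $(x,y)\in A\times B$. $W$ is irreducible if there is no measurable $B$ with $0<\mu(B)<1$ and $B\prec\mathcal S\setminus B$. $W$ is transitive if $W(x,y)>0$ and $W(y,z)>0$ imply $W(x,z)=1$ for $\mu^3$-a.e. $(x,y,z)$. $\mathcal Z$ is the family of measurable $A\subseteq\mathcal S$ for which there is a partition $\{B,C\}$ of $\mathcal S\setminus A$ into measurable (possibly empty) sets with $B\prec A$, $A\prec C$, $B\prec C$; $\sigma(\mathcal Z)$ is the generated $\sigma$-algebra. An atom is $A\in\sigma(\mathcal Z)$ with $\mu(A)>0$ and no $A'\in\sigma(\mathcal Z)$, $A'\subseteq A$, with $0<\mu(A')<\mu(A)$; there are countably many atoms (up to null sets), indexed by $\mathcal Q$. Construction of $\eta$: write $\alpha_j=\mu(\mathcal S_j)$. For $x\in\mathcal S$ let $R_x=\{j\in\mathcal Q: W(x,y)=1\text{ for }\mu\text{-a.e. }y\in\mathcal S_j\}$ and $\Lambda(x)=\int_{\mathcal I}W(x,y)\,d\mu(y)+\sum_{j\in R_x}\alpha_j$. Define $\eta:\mathcal Q\cup\mathcal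 I\to[0,1]$ by $\eta(x)=1-\Lambda(x)$ for $x\in\mathcal I$ and $\eta(i)=1-\frac1{\mu(\mathcal S_i)}\int_{\mathcal S_i}\Lambda\,d\mu-\mu(\mathcal S_i)$ for $i\in\mathcal Q$. Direct sum of kernels $\left(\bigoplus_{i\in\mathcal Q}\alpha_iW_i,\mathcal I,\eta\right)$, for a countable $\mathcal Q$, a non-atomic probability space $(\mathcal I,\mu_{\mathcal I})$, $\alpha_i\ge0$ with $\sum\alpha_i\le1$, tournament kernels $W_i$ on $(\mathcal S_i,\mu_i)$ and $\eta:\mathcal Q\cup\mathcal I\to[0,1]$ with $\eta|_{\mathcal Q}$ injective and $\eta|_{\mathcal I}$ injective up to null sets: it is the kernel on $\mathcal I\sqcup\bigsqcup_i\mathcal S_i$ with measure $\sum_i\alpha_i\mu_i+(1-\sum_i\alpha_i)\mu_{\mathcal I}$, given by $W(x,y)=W_i(x,y)$ if $x,y\in\mathcal S_i$, $W(x,y)=1$ if $\eta(x)<\eta(y)$, $W(x,y)=0$ if $\eta(x)>\eta(y)$, where $\eta(x):=\eta(i)$ for $x\in\mathcal S_i$. *)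

(* Defs.v *)
From mathcomp Require Export all_boot all_order all_algebra.
From mathcomp Require Export all_classical all_reals all_analysis.
Export Order.TTheory GRing.Theory Num.Theory.
Export numFieldNormedType.Exports.

#[export] Set Implicit Arguments.
#[export] Unset Strict Implicit.
#[export] Unset Printing Implicit Defensive.

Local Open Scope classical_set_scope.
Local Open Scope ring_scope.
Local Open Scope ereal_scope.

(* The probability space (D, nu), for a measurable part D of T, is represented
   by D and a probability nu on T with nu D = 1; a kernel on it is a function
   on T whose values are only looked at on D * D.  The whole space is
   D = setT. *)

Section conditioning.
Context {d : measure_display} {T : measurableType d} {R : realType}.

(* B |-> P (B `&` A) / P A, for A measurable with P A > 0; it is P otherwise. *)
Definition cond_prob (P : probability T R) (A : set T) : probability T R :=
  match pselect (measurable A) with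
  | left mA => mnormalize (mrestr P mA) P
  | right _ => P
  end.

End conditioning.

Section kernels.
Context {d : measure_display} {T : measurableType d} {R : realType}.
Implicit Types (D A B C : set T) (nu : probability T R) (W : T -> T -> R).

Definition tournament_kernel D nu W :=
  [/\ measurable_fun (D `*` D) (fun p : T * T => W p.1 p.2),
      forall x y, D x -> D y -> (0 <= W x y <= 1)%R &
      {ae nu \x nu, forall p : T * T, D p.1 -> D p.2 ->
         (W p.1 p.2 + W p.2 p.1 = 1)%R}].

Definition prec nu W A B :=
  [/\ measurable A, measurable B, nu (A `&` B) = 0 &
      {ae nu \x nu, forall p : T * T, A p.1 -> B p.2 -> W p.1 p.2 = 1%R}].

Definition irreducible_kernel D nu W :=
  ~ exists B : set T,
      [/\ measurable B, B `<=` D, 0 < nu B < 1 & prec nu W B (D `\` B)].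

Definition transitive_kernel D nu W :=
  {ae nu \x nu \x nu, forall p : T * T * T,
     D p.1.1 -> D p.1.2 -> D p.2 ->
     (0 < W p.1.1 p.1.2)%R -> (0 < W p.1.2 p.2)%R -> W p.1.1 p.2 = 1%R}.

Definition Zfamily nu W : set (set T) :=
  [set A | measurable A /\
     exists B C : set T,
       [/\ measurable B, measurable C, B `|` C = ~` A & B `&` C = set0] /\
       [/\ prec nu W B A, prec nu W A C & prec nu W B C]].

Definition sigmaZ nu W : set (set T) := <<s Zfamily nu W >>.

Definition atom (G : set (set T)) nu A :=
  [/\ G A, 0 < nu A &
      ~ exists A' : set T, [/\ G A', A' `<=` A & 0 < nu A' < nu A]].

Definition nonatomic (G : set (set T)) D nu :=
  forall A, A `<=` D -> ~ atom G nu A.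

End kernels.

Section atoms.
Context {d : measure_display} {T : measurableType d} {R : realType}.
Context {Q : countType}.
Implicit Types (S : Q -> set T) (mu : probability T R) (W : T -> T -> R).

(* Atoms only matter up to null sets: S picks one representative in each class,
   and the representatives are chosen disjoint. *)
Definition atom_enumeration (G : set (set T)) mu S :=
  [/\ forall i, atom G mu (S i),
      trivIset [set: Q] S &
      forall A, atom G mu A ->
        exists i, mu ((A `\` S i) `|` (S i `\` A)) = 0].

Definition nonatomic_part S : set T := ~` \bigcup_i S i.

Definition dominated_atoms mu W S (x : T) : set Q :=
  [set j | {ae mu, forall y, S j y -> W x y = 1%R}].

Definition Lambda mu W S (x : T) : \bar R :=
  \int[mu]_(y in nonatomic_part S) (W x y)%:E
  + \esum_(j in dominated_atoms mu W S x) mu (S j).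

(* Defined on the disjoint union of Q and nonatomic_part S; the values at
   inr x for x outside nonatomic_part S are irrelevant. *)
Definition eta_map mu W S (u : Q + T) : R :=
  match u with
  | inl i => (1 - (fine (mu (S i)))^-1 * fine (\int[mu]_(x in S i) Lambda mu W S x)
              - fine (mu (S i)))%R
  | inr x => (1 - fine (Lambda mu W S x))%R
  end.

End atoms.

(* The direct sum of kernels (\bigoplus_i alpha_i W_i, I, eta), where the
   disjoint union of I and the S_i is realised inside one space T, the S_i
   being disjoint parts of T and I the rest. *)
Section direct_sum.
Context {d : measure_display} {T : measurableType d} {R : realType}.
Context {Q : countType}.

Definition dsum_measure (alpha : Q -> \bar R) (mu_ : Q -> probability T R)
    (muI : probability T R) (A : set T) : \bar R :=
  (1 - \esum_(i in [set: Q]) alpha i) * muI A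
  + \esum_(i in [set: Q]) (alpha i * mu_ i A).

Definition dsum_eta (S : Q -> set T) (eta : Q + T -> R) (x : T) : R :=
  match pselect (exists i, S i x) with
  | left h => eta (inl (projT1 (cid h)))
  | right _ => eta (inr x)
  end.

(* The last value (x and y not in the same S_i but with the same eta) is
   arbitrary: it is taken on a null set when eta is injective as required. *)
Definition dsum_kernel (S : Q -> set T) (W_ : Q -> T -> T -> R)
    (eta : Q + T -> R) (x y : T) : R :=
  match pselect (exists i, S i x /\ S i y) with
  | left h => W_ (projT1 (cid h)) x y
  | right _ =>
      if (dsum_eta S eta x < dsum_eta S eta y)%R then 1%R
      else if (dsum_eta S eta y < dsum_eta S eta x)%R then 0%R
      else (2^-1)%R
  end.

End direct_sum.

(* Main.v *)
(* Call a measurable U a cut if U precedes its complement. The members of Z are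
   the differences of nested cuts; cuts are closed under countable unions and
   intersections, and W x y + W y x = 1 makes them a chain up to null sets.
   Let h x be the measure of the smallest cut containing x, obtained as an
   infimum over maximal cuts of measure at most q, q rational. Then every cut is
   a.e. of the form {h <= u}, W x y = 1 for a.e. pair with h x < h y, and
   mu {h <= h x} = h x. Hence the atoms of sigma(Z) are, up to null sets, the
   levels {h = t_i} of positive measure, and h is injective up to null sets on
   the rest. Moreover Lambda = 1 - h a.e., so that eta = h a.e. on the nonatomic
   part, while eta(i) = t_i - mu(S_i) = mu {h < t_i}: eta and h order a.e. pair
   of points of different components in the same way. *)

From mathcomp Require Import measurable_realfun lra.
Require Import Defs.

Local Open Scope classical_set_scope.
Local Open Scope ring_scope.
Local Open Scope ereal_scope.

(** Precedence is only known up to null sets, and the null sets of uncountably many cuts cannot be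
    united. So only countably many cuts [V q], chosen as sets rather than as classes, enter the
    definition of [h]; this makes [h] a genuine function, with mu {h <= h x} = h x at every x. Why
    Lambda = 1 - h: for a.e. x, W x y is 1 when h y > h x and 0 when h y < h x, and levels are null
    inside the nonatomic part. The dominated atoms are those with t_j > h x; the atom of x itself is
    left out because only a null set of its points can dominate it. The two terms of Lambda then add
    up to mu {h > h x}. The delicate point is that eta lies below h by mu(S_i) on the atom S_i, so
    the order could change there. It does not: if h x < t_i, then {h <= h x} is inside {h < t_i}, so
    h x <= t_i - mu(S_i). Hence h has no value strictly between t_i - mu(S_i) and t_i, and the left
    endpoint, being a single level, is attained on the nonatomic part only on a null set. *)

Lemma exists_natSinv_lt {R : realType} (e : R) : (0 < e)%R ->
  exists n : nat, (n.+1%:R^-1 < e)%R.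
Proof.
move=> e0; have := near_infty_natSinv_lt (PosNum e0).
by case=> N _ /(_ N (leqnn _)) /= ?; exists N.
Qed.

(** * Almost everywhere statements on products *)

Section almost_everywhere_products.
Context {d1 d2 : measure_display} {T1 : measurableType d1}
  {T2 : measurableType d2} {R : realType}.
Context (m1 : {measure set T1 -> \bar R})
  (m2 : {sigma_finite_measure set T2 -> \bar R}).

(** Tonelli: the product measure integrates the measures of the sections, and a nonnegative function
    has integral 0 exactly when it vanishes a.e. *)
Lemma product_measure_eq0P (N : set (T1 * T2)) : measurable N ->
  (m1 \x m2) N = 0 <-> {ae m1, forall x, m2 (xsection N x) = 0}.
Proof.
move=> mN; have mf := measurable_fun_xsection m2 mN.
have -> : (m1 \x m2) N = \int[m1]_x `|m2 (xsection N x)|.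
  by apply: eq_integral => x _; rewrite /= gee0_abs.
split.
  move/(ae_eq_integral_abs m1 measurableT mf) => h.
  by apply: filterS h => x; exact.
move=> h; apply/(ae_eq_integral_abs m1 measurableT mf).
by apply: filterS h => x.
Qed.

Lemma ae_prod_xsection (P : T1 * T2 -> Prop) :
  {ae m1 \x m2, forall p, P p} ->
  {ae m1, forall x, {ae m2, forall y, P (x, y)}}.
Proof.
move=> [N [mN N0 PN]]; have := (product_measure_eq0P mN).1 N0.
apply: filterS => x Nx0; exists (xsection N x); split => //.
  exact: measurable_xsection.
by move=> y /= nP; rewrite /xsection/= inE; exact: PN.
Qed.

Lemma ae_prod_fst (P : T1 -> Prop) :
  {ae m1, forall x, P x} -> {ae m1 \x m2, forall p, P p.1}.
Proof.
move=> [N [mN N0 PN]]; exists (N `*` setT); split.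
- exact: measurableX.
- by rewrite product_measure1E// [X in X * _]N0 mul0e.
- by move=> p /= nP; split => //; exact: PN.
Qed.

Lemma ae_prod_snd (P : T2 -> Prop) :
  {ae m2, forall x, P x} -> {ae m1 \x m2, forall p, P p.2}.
Proof.
move=> [N [mN N0 PN]]; exists (setT `*` N); split.
- exact: measurableX.
- by rewrite product_measure1E// [X in _ * X]N0 mule0.
- by move=> p /= nP; split => //; exact: PN.
Qed.

End almost_everywhere_products.

Lemma ae_dominates {d} {T : measurableType d} {R : realType}
    (m n : {measure set T -> \bar R}) (P : T -> Prop) :
  content_dominates m n -> {ae m, forall x, P x} -> {ae n, forall x, P x}.
Proof. by move=> mn [N [mN N0 PN]]; exists N; split => //; exact: mn. Qed.

(** Carries a.e. statements on pairs from [mu] to its conditional probabilities. *)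
Lemma prod_dominates {d1 d2 : measure_display} {T1 : measurableType d1}
    {T2 : measurableType d2} {R : realType}
    (m1 n1 : {measure set T1 -> \bar R})
    (m2 n2 : {sigma_finite_measure set T2 -> \bar R}) :
  content_dominates m1 n1 -> content_dominates m2 n2 ->
  content_dominates (m1 \x m2) (n1 \x n2).
Proof.
move=> mn1 mn2 N mN /(product_measure_eq0P m1 m2 mN) N0.
apply/product_measure_eq0P => //; apply: ae_dominates mn1 _.
by apply: filterS N0 => x; apply: mn2; exact: measurable_xsection.
Qed.

(** Meant for triples ((x, y), z): with [f] a projection of (x, y), a statement on pairs becomes one
    on (x, z) or (y, z). *)
Lemma ae_prod_comp_fst {d0 d1 d2 : measure_display} {T0 : measurableType d0}
    {T1 : measurableType d1} {T2 : measurableType d2} {R : realType}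
    (m0 : {measure set T0 -> \bar R})
    (m1 : {measure set T1 -> \bar R})
    (m2 : {sigma_finite_measure set T2 -> \bar R})
    (f : T0 -> T1) (P : T1 * T2 -> Prop) : measurable_fun [set: T0] f ->
  (forall X : T1 -> Prop,
     {ae m1, forall x, X x} -> {ae m0, forall x, X (f x)}) ->
  {ae m1 \x m2, forall p, P p} ->
  {ae m0 \x m2, forall p : T0 * T2, P (f p.1, p.2)}.
Proof.
move=> mf aef [N [mN N0 PN]].
pose g (p : T0 * T2) := (f p.1, p.2).
have mg : measurable_fun setT g.
  by apply: measurable_fun_pair => //; exact: measurableT_comp.
have mgN : measurable (g @^-1` N) by rewrite -[_ @^-1` _]setTI; exact: mg.
exists (g @^-1` N); split => //; last by move=> p nP; exact: PN.
apply/product_measure_eq0P => //.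
exact: aef _ ((product_measure_eq0P m1 m2 mN).1 N0).
Qed.

Lemma ae_prod_swap {d} {T : measurableType d} {R : realType}
    (m : {sigma_finite_measure set T -> \bar R}) (P : T * T -> Prop) :
  {ae m \x m, forall p, P p} -> {ae m \x m, forall p, P (p.2, p.1)}.
Proof.
move=> [N [mN N0 PN]].
pose sw (p : T * T) := (p.2, p.1).
have mN' : measurable (sw @^-1` N).
  have msw : measurable_fun setT sw by apply: measurable_fun_pair.
  by rewrite -[_ @^-1` _]setTI; exact: msw.
exists (sw @^-1` N); split => //; last by move=> p nP; exact: PN.
(* The y-sections of the swapped set are the x-sections of [N]. *)
have -> : (m \x m) (sw @^-1` N) = (m \x^ m) (sw @^-1` N).
  apply: (@product_measure_unique _ _ _ _ R m m (m \x^ m)%E) => //.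
  by move=> A B mA mB; exact: product_measure2E.
rewrite /product_measure2 -[RHS]N0; apply: eq_integral => x _ /=.
by congr (m _); apply/seteqP; split => y /=; rewrite /xsection /ysection/= !inE.
Qed.

Lemma ae_forall_countable {d} {T : measurableType d} {R : realType}
    (m : {measure set T -> \bar R}) (J : countType) (P : J -> T -> Prop) :
  (forall j, {ae m, forall x, P j x}) -> {ae m, forall x, forall j, P j x}.
Proof.
move=> mP.
have : {ae m, forall x, forall n, if unpickle n is Some j then P j x else True}.
  apply: ae_foralln => n; case: unpickle => [j|]; first exact: mP.
  exact: aeW.
by apply: filterS => x h j; have := h (pickle j); rewrite pickleK.
Qed.

(** * Sums and disjoint unions over a countable type *)

Section countable_sums.
Context {R : realType} {Q : countType}.

(** As a series over [nat], the sum is open to sigma-additivity and to measurability of series;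
    naturals that code no element of [D] contribute 0. *)
Lemma esum_countable (D : set Q) (a : Q -> \bar R) : (forall j, 0 <= a j) ->
  \esum_(j in D) a j =
  \sum_(n <oo) (if pickle_inv n is Some j then
                  if j \in D then a j else 0 else 0).
Proof.
move=> a0; rewrite nneseries_esumT; last first.
  by move=> n; case: pickle_inv => // j; case: ifP.
rewrite esum_mkcond.
pose b n := if pickle_inv n is Some j then if j \in D then a j else 0 else 0.
rewrite -(_ : \esum_(n in (@pickle Q) @` setT) b n = \esum_(n in setT) b n).
  rewrite esum_image; last by move=> i j _ _; exact: (pcan_inj (@pickleK Q)).
  by apply: eq_esum => i _; rewrite /b pickleK_inv.
rewrite esum_mkcond; apply: eq_esum => n _; case: ifPn => //.
rewrite notin_setE /b /= => nn.
case E : pickle_inv => [j|//]; exfalso; apply: nn; exists j => //.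
by have := @pickle_invK Q n; rewrite E.
Qed.

Lemma measure_bigcup_countable {d} {T : measurableType d}
    (m : {measure set T -> \bar R}) (D : set Q) (F : Q -> set T) :
  (forall j, measurable (F j)) -> trivIset D F ->
  m (\bigcup_(j in D) F j) = \esum_(j in D) m (F j).
Proof.
move=> mF tF; rewrite esum_countable//.
pose G n := if pickle_inv n is Some j then
  if j \in D then F j else set0 else set0.
have -> : \bigcup_(j in D) F j = \bigcup_n G n.
  apply/seteqP; split => [x [j Dj Fjx]|x [n _]].
    by exists (pickle j) => //; rewrite /G pickleK_inv mem_set.
  rewrite /G; case: pickle_inv => // j.
  by case: ifPn => // /set_mem Dj Fx; exists j.
rewrite measure_bigcup//.
- rewrite (eq_eseriesl (Q := xpredT)); last by move=> n; rewrite in_setT.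
  apply: eq_eseriesr => n _; rewrite /G; case: pickle_inv => [j|]; last first.
    by rewrite measure0.
  by case: ifP; rewrite ?measure0.
- move=> n _; rewrite /G; case: pickle_inv => // j.
  by case: ifP.
- move=> n k _ _ [x []]; rewrite /G.
  case En : pickle_inv => [i|//]; case: ifPn => // /set_mem Di Fi.
  case Ek : pickle_inv => [j|//]; case: ifPn => // /set_mem Dj Fj.
  have ij : i = j by apply: tF => //; exists x.
  have := @pickle_invK Q n; have := @pickle_invK Q k; rewrite En Ek /= ij.
  by move=> -> ->.
Qed.

End countable_sums.

Section probability_null_sets.
Context {d : measure_display} {T : measurableType d} {R : realType}
  (mu : probability T R).

Lemma fine_prob (A : set T) : measurable A -> (fine (mu A))%:E = mu A.
Proof. by move=> mA; rewrite fineK// fin_num_measure. Qed.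

Lemma probDI (A B : set T) : measurable A -> measurable B ->
  mu A = mu (A `\` B) + mu (A `&` B).
Proof. by move=> mA mB; rewrite (measureDI mu mA mB). Qed.

Lemma fine_probDI (A B : set T) : measurable A -> measurable B ->
  fine (mu A) = (fine (mu (A `\` B)) + fine (mu (A `&` B)))%R.
Proof.
move=> mA mB; rewrite (probDI mA mB) fineD// fin_num_measure//.
  exact: measurableD.
exact: measurableI.
Qed.

Lemma measureD_eq0 (A B : set T) : measurable A -> measurable B ->
  mu (A `\` B) = 0 -> mu B <= mu A -> mu (B `\` A) = 0.
Proof.
move=> mA mB AB0.
rewrite -(fine_prob mA) -(fine_prob mB) lee_fin (fine_probDI mA mB).
rewrite AB0 (fine_probDI mB mA) (setIC B) /= => h.
have mBA := measurableD mB mA.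
rewrite -(fine_prob mBA); congr EFin.
have := fine_ge0 (measure_ge0 mu (B `\` A)); lra.
Qed.

Lemma ae_measure_eq (A B : set T) : measurable A -> measurable B ->
  {ae mu, forall x, A x <-> B x} -> mu A = mu B.
Proof.
move=> mA mB [N [mN N0 ABN]].
have mD X : measurable X -> mu (X `\` N) = mu X.
  move=> mX; rewrite [in RHS](probDI mX mN).
  rewrite [X in _ = _ + X](_ : _ = 0) ?adde0//.
  by apply: (subset_measure0 _ mN _ N0); [exact: measurableI|exact: subIsetr].
rewrite -(mD A)// -(mD B)//; congr (mu _); apply/seteqP; split => x [Xx nN].
- split => //; have [AB _] : A x <-> B x by apply: contrapT => /ABN.
  exact: AB.
- split => //; have [_ BA] : A x <-> B x by apply: contrapT => /ABN.
  exact: BA.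
Qed.

(** Provides a typical point of an atom, at which facts about its level are read off. *)
Lemma ae_exists (A : set T) (P : T -> Prop) : measurable A -> 0 < mu A ->
  {ae mu, forall x, P x} -> exists2 x, A x & P x.
Proof.
move=> mA A0 [N [mN N0 PN]]; apply: contrapT => nP.
suff : mu A = 0 by move/eqP; rewrite gt_eqF.
apply: (subset_measure0 mA mN _ N0) => x Ax; apply: PN => /= Px.
by apply: nP; exists x.
Qed.

Lemma ae_notin (A : set T) : measurable A -> mu A = 0 ->
  {ae mu, forall x, ~ A x}.
Proof. by move=> mA A0; exists A; split => // x /contrapT. Qed.

End probability_null_sets.

(** * Cuts *)

Section cuts.
Context {d : measure_display} {T : measurableType d} {R : realType}
  (mu : probability T R) (W : T -> T -> R).

Definition cut (U : set T) := measurable U /\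
  {ae mu \x mu, forall p : T * T, U p.1 -> ~ U p.2 -> W p.1 p.2 = 1%R}.

Lemma cutT : cut setT.
Proof. by split => //; apply: aeW => p _ []. Qed.

Lemma cut0 : cut set0.
Proof. by split => //; apply: aeW => p []. Qed.

Lemma Zfamily_cutD A : Zfamily mu W A ->
  exists B U : set T, [/\ cut B, cut U & A = U `\` B].
Proof.
move=> [mA [B [C [[mB mC BC BC0]]]]] [[_ _ _ BA] [_ _ _ AC] [_ _ _ hBC]].
have cases x : [\/ A x, B x | C x].
  have [Ax|nAx] := pselect (A x); first by constructor 1.
  by have : (~` A) x by []; rewrite -BC => -[]; [constructor 2|constructor 3].
exists B, (~` C); split.
- split => //; apply: filterS2 BA hBC => p h1 h2 Bp nB.
  by case: (cases p.2) => // ?; [exact: h1|exact: h2].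
- split; first exact: measurableC.
  apply: filterS2 AC hBC => p h1 h2 nC /contrapT Cp.
  by case: (cases p.1) => // ?; [exact: h1|exact: h2].
- apply/seteqP; split => x.
    by move=> Ax; split => nx; have : (B `|` C) x; [right| |left|];
      rewrite // BC => /(_ Ax).
  by case=> nC nB; case: (cases x).
Qed.

Lemma cut_Zfamily U : cut U -> Zfamily mu W U.
Proof.
move=> [mU h]; split=> //; exists set0, (~` U).
have mUc : measurable (~` U) by exact: measurableC.
split; [split; rewrite ?set0U ?set0I//|
  split; split; rewrite ?set0I ?setICr ?measure0//].
- by apply: aeW => p.
- by apply: aeW => p.
Qed.

Lemma sigmaZ_cut U : cut U -> sigmaZ mu W U.
Proof. by move=> /cut_Zfamily; exact: sub_sigma_algebra. Qed.

Lemma sigmaZ_measurable A : sigmaZ mu W A -> measurable A.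
Proof.
move: A; apply: smallest_sub; first exact: sigma_algebra_measurable.
by move=> A [].
Qed.

(** A pair that crosses the union crosses some [U j]; countability keeps the union of the
    exceptional sets null. *)
Lemma cut_bigcup (J : countType) (D : set J) (U : J -> set T) :
  (forall j, D j -> cut (U j)) -> cut (\bigcup_(j in D) U j).
Proof.
move=> cU; split.
  rewrite bigcup_mkcond; apply: countable_bigcupT_measurable => // j.
  by case: ifPn => // /set_mem /cU[].
have : {ae mu \x mu, forall p : T * T, forall j, D j ->
    U j p.1 -> ~ U j p.2 -> W p.1 p.2 = 1%R}.
  apply: ae_forall_countable => j.
  have [/cU[_ h]|nD] := pselect (D j); first by apply: filterS h => p hp _.
  exact: aeW.
apply: filterS => p h [j Dj Uj] nU.
by apply: (h j) => // Uj2; apply: nU; exists j.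
Qed.

Lemma cut_bigcap (J : countType) (D : set J) (U : J -> set T) :
  (forall j, D j -> cut (U j)) -> cut (\bigcap_(j in D) U j).
Proof.
move=> cU; split.
  rewrite -[X in measurable X]setCK setC_bigcap bigcup_mkcond.
  apply: measurableC; apply: countable_bigcupT_measurable => // j.
  by case: ifPn => // /set_mem /cU[mU _]; exact: measurableC.
have : {ae mu \x mu, forall p : T * T, forall j, D j ->
    U j p.1 -> ~ U j p.2 -> W p.1 p.2 = 1%R}.
  apply: ae_forall_countable => j.
  have [/cU[_ h]|nD] := pselect (D j); first by apply: filterS h => p hp _.
  exact: aeW.
apply: filterS => p h Up nU.
have [j Dj Uj] : exists2 j, D j & ~ U j p.2.
  apply: contrapT => nj; apply: nU => j Dj; apply: contrapT => nUj.
  by apply: nj; exists j.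
by apply: (h j) => //; exact: Up.
Qed.

(* The third clause normalises h: h x is the measure of the smallest cut
   containing x. *)
Definition position (h : T -> R) :=
  [/\ forall x, (0 <= h x <= 1)%R,
      forall t, cut [set x | (h x < t)%R] /\ cut [set x | (h x <= t)%R],
      forall x, mu [set y | (h y <= h x)%R] = (h x)%:E &
      forall U, cut U -> exists u,
        mu (U `\` [set x | (h x <= u)%R]) = 0 /\
        mu ([set x | (h x <= u)%R] `\` U) = 0].

Context (hW : tournament_kernel [set: T] mu W).

(** On (U [\] V) x (V [\] U) both W x y and W y x are a.e. 1, against their sum being 1; so this
    rectangle is null, hence one of its sides. *)
Lemma cut_chain U V : cut U -> cut V -> mu (U `\` V) = 0 \/ mu (V `\` U) = 0.
Proof.
move=> [mU hU] [mV hV]; have [_ _ hS] := hW.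
have mUV := measurableD mU mV; have mVU := measurableD mV mU.
suff : (mu \x mu) ((U `\` V) `*` (V `\` U)) = 0.
  rewrite product_measure1E// => /eqP.
  by rewrite mule_eq0 => /orP[] /eqP; [left|right].
apply/negligibleP; first exact: measurableX.
apply: negligibleS (_ : (mu \x mu).-negligible
  (~` [set p | ~ ((U `\` V) p.1 /\ (V `\` U) p.2)])).
  by move=> p [? ?] /=; exact.
have hV' := ae_prod_swap hV.
apply: filterS3 hU hV' hS => p h1 h2 h3 [[Ux nVx] [Vy nUy]].
have := h3 I I; rewrite (h1 Ux nUy) (h2 Vy nVx) => /eqP.
by apply/negP; rewrite neq_lt; apply/orP; right; lra.
Qed.

(** By [cut_chain] the union is, up to a null set, one of the two cuts. *)
Lemma cutU_le U V (q : \bar R) : cut U -> cut V -> mu U <= q -> mu V <= q ->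
  mu (U `|` V) <= q.
Proof.
move=> cU cV Uq Vq; have [mU _] := cU; have [mV _] := cV.
have le_q A B : measurable A -> measurable B -> mu (A `\` B) = 0 ->
    mu B <= q -> mu (A `|` B) <= q.
  move=> mA mB AB0 Bq.
  have -> : A `|` B = (A `\` B) `|` B.
    by rewrite setUDl setDv setD0.
  apply: le_trans (measureU2 _ _ _) _ => //; first exact: measurableD.
  by rewrite [X in X + _]AB0 add0e.
have [h|h] := cut_chain cU cV; first exact: le_q.
by rewrite setUC; exact: le_q.
Qed.

Lemma cut_bigcup_le_nat (U : nat -> set T) (q : \bar R) : 0 <= q ->
  (forall n, cut (U n)) -> (forall n, mu (U n) <= q) -> mu (\bigcup_n U n) <= q.
Proof.
move=> q0 cU Uq.
pose F n := \big[setU/set0]_(i < n.+1) U i.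
have FE n : cut (F n) /\ mu (F n) <= q.
  elim: n => [|n [cF Fq]]; first by rewrite /F big_ord1.
  rewrite /F big_ord_recr /=; split; last exact: cutU_le.
  rewrite -bigcup2E; apply: (@cut_bigcup nat setT) => -[|[|j]] _ //=.
  exact: cut0.
rewrite -bigcup_bigsetU_bigcup -/F.
have mF : measurable (\bigcup_n F n).
  by apply: bigcupT_measurable => n; have [[]] := FE n.
have := @nondecreasing_cvg_mu _ _ _ mu F (fun n => (FE n).1.1) mF.
move/(_ _)/cvg_lim => <- //.
  apply: lime_le; last by apply: nearW => n /=; exact: (FE n).2.
  apply: (cvgP (mu (\bigcup_n F n))); apply: nondecreasing_cvg_mu => //.
    by move=> n; exact: (FE n).1.1.
  by move=> m n mn; apply/subsetPset; apply: subset_bigsetU.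
by move=> m n mn; apply/subsetPset; apply: subset_bigsetU.
Qed.

Lemma cut_bigcup_le (J : countType) (D : set J) (U : J -> set T) (q : \bar R) :
  0 <= q -> (forall j, D j -> cut (U j)) ->
  (forall j, D j -> mu (U j) <= q) -> mu (\bigcup_(j in D) U j) <= q.
Proof.
move=> q0 cU Uq.
pose G n := if pickle_inv n is Some j then
  if j \in D then U j else set0 else set0.
have -> : \bigcup_(j in D) U j = \bigcup_n G n.
  apply/seteqP; split => [x [j Dj Fjx]|x [n _]].
    by exists (pickle j) => //; rewrite /G pickleK_inv mem_set.
  rewrite /G; case: pickle_inv => // j.
  by case: ifPn => // /set_mem Dj Fx; exists j.
apply: cut_bigcup_le_nat => // n; rewrite /G.
  case: pickle_inv => [j|]; last exact: cut0.
  by case: ifPn => [/set_mem /cU//|_]; exact: cut0.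
case: pickle_inv => [j|]; last by rewrite measure0.
by case: ifPn => [/set_mem /Uq//|_]; rewrite measure0.
Qed.

(** The union U of a maximizing sequence is still a cut of measure at most q, so it attains the
    supremum. For a competitor X, X [|] U is again admissible, hence no larger than U in measure. *)
Lemma exists_maximal_cut (q : R) : (0 <= q)%R -> exists U,
  [/\ cut U, mu U <= q%:E &
      forall V, cut V -> mu V <= q%:E -> mu (V `\` U) = 0].
Proof.
move=> q0.
pose E := [set mu V | V in [set V | cut V /\ mu V <= q%:E]].
have E0 : E 0.
  exists set0; last by rewrite measure0.
  by split; [exact: cut0|rewrite measure0 lee_fin].
have supfin : ereal_sup E \is a fin_num.
  rewrite fin_numElt; apply/andP; split.
    by apply: (@lt_le_trans _ _ 0) => //; exact: ereal_sup_ubound.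
  apply: (@le_lt_trans _ _ q%:E); last exact: ltry.
  by apply: ge_ereal_sup => _ [V [_ ?] <-].
have ex n : exists V, [/\ cut V, mu V <= q%:E &
    ereal_sup E - (n.+1%:R^-1)%:E < mu V].
  have n0 : (0 < n.+1%:R^-1 :> R)%R by rewrite invr_gt0 ltr0n.
  by have [_ [V [cV Vq] <-] h] := ub_ereal_sup_adherent n0 supfin; exists V.
have [V hV] := choice ex.
have cV n : cut (V n) by have [] := hV n.
have Vq n : mu (V n) <= q%:E by have [] := hV n.
have cU : cut (\bigcup_n V n) by exact: cut_bigcup.
have Uq : mu (\bigcup_n V n) <= q%:E by exact: cut_bigcup_le_nat.
exists (\bigcup_n V n); split => // X cX Xq.
set U := \bigcup_n V n in cU Uq *.
have mU : measurable U by case: cU.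
have cXU : cut (X `|` U).
  rewrite -bigcup2E; apply: (@cut_bigcup nat setT) => -[|[|j]] _ //=.
  exact: cut0.
have -> : X `\` U = (X `|` U) `\` U.
  by apply/seteqP; split => x [] //; [split => //; left|case].
apply: measureD_eq0 => //; first exact: cXU.1.
  rewrite -[RHS](@measure0 _ _ _ mu); congr (mu _).
  by rewrite setDUr setDv setI0.
apply: (@le_trans _ _ (ereal_sup E)).
  apply: ereal_sup_ubound; exists (X `|` U) => //.
  by split => //; exact: cutU_le.
apply/lee_addgt0Pr => e e0.
have [n ne] := exists_natSinv_lt e0.
have [_ _ h] := hV n; rewrite -leeBlDr//; apply: le_trans (_ : mu (V n) <= _).
  apply: le_trans (ltW h); rewrite leeB// lee_fin; exact: ltW.
by apply: le_measure; rewrite ?inE//; [exact: (cV n).1|exact: bigcup_sup].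
Qed.

(** [V 1] is the whole space exactly, not just a.e., so that every point lies in some [V q] and the
    infimum defining the position is over a nonempty set. *)
Lemma cut_family : exists V : rat -> set T,
  [/\ forall q, cut (V q),
      forall q, (0 <= q)%R -> mu (V q) <= (ratr q)%:E,
      forall q U, cut U -> mu U <= (ratr q)%:E -> mu (U `\` V q) = 0 &
      V 1%R = setT].
Proof.
have ex (q : rat) : exists U, [/\ cut U, (0 <= q)%R -> mu U <= (ratr q)%:E,
    forall X, cut X -> mu X <= (ratr q)%:E -> mu (X `\` U) = 0 &
    (1 <= q)%R -> U = setT].
  have [q1|q1] := leP 1%R q.
    exists setT; split=> //; first exact: cutT.
    - move=> _; rewrite probability_setT lee_fin.
      by rewrite -(rmorph1 (@ratr R)) ler_rat.
    - by move=> X _ _; rewrite setDT measure0.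
  have [q0|q0] := leP 0%R q.
    have := @exists_maximal_cut (ratr q); rewrite ler0q => /(_ q0)[U [? ? ?]].
    by exists U; split.
  exists set0; split => //; first exact: cut0.
    by move=> X _; rewrite leNgt (@lt_le_trans _ _ 0)// lte_fin ltrq0.
have [V hV] := choice ex; exists V; split.
- by move=> q; have [] := hV q.
- by move=> q; have [] := hV q.
- by move=> q; have [] := hV q.
- by have [_ _ _] := hV 1%R; apply.
Qed.

(** The infimum runs over countably many cuts, so {h < t} is a countable union of them and {h <= t}
    a countable intersection of sets {h < t + 1/(n+1)}. *)
Lemma exists_position : exists h, position h.
Proof.
have [V [cV Vle Vmax VT]] := cut_family.
have mV q : measurable (V q) by have [] := cV q.
pose E x := [set fine (mu (V q)) | q in [set q | V q x]].
have E0 x : E x !=set0.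
  by exists (fine (mu (V 1%R))); exists 1%R => //=; rewrite VT.
have Elb x : has_lbound (E x) by exists 0%R => _ [q _ <-]; exact: fine_ge0.
pose h x := inf (E x).
have h_le x q : V q x -> (h x <= fine (mu (V q)))%R.
  by move=> Vqx; apply: ge_inf => //; exists q.
have hltP x t : (h x < t)%R <-> exists2 q, V q x & (fine (mu (V q)) < t)%R.
  split => [hxt|[q Vqx]]; last by apply: le_lt_trans; exact: h_le.
  have := @inf_adherent _ (E x) (t - h x) _ (conj (E0 x) (Elb x)).
  rewrite subr_gt0 => /(_ hxt)[_ [q Vqx <-]].
  by rewrite addrC subrK => ?; exists q.
have h01 x : (0 <= h x <= 1)%R.
  apply/andP; split.
    by apply: lb_le_inf => // _ [q _ <-]; exact: fine_ge0.
  apply: le_trans (h_le x 1%R _) _; first by rewrite VT.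
  by rewrite VT probability_setT.
have ltE t : [set x | (h x < t)%R] =
    \bigcup_(q in [set q | (fine (mu (V q)) < t)%R]) V q.
  apply/seteqP; split => [x /hltP[q ? ?]|x [q ? ?]]; first by exists q.
  by apply/hltP; exists q.
have cut_lt t : cut [set x | (h x < t)%R] by rewrite ltE; exact: cut_bigcup.
have lt_le t : (0 <= t)%R -> mu [set x | (h x < t)%R] <= t%:E.
  move=> t0; rewrite ltE; apply: cut_bigcup_le => //= q qt.
  by rewrite -(fine_prob mu (mV q)) lee_fin ltW.
have leE t : [set x | (h x <= t)%R] =
    \bigcap_n [set x | (h x < t + n.+1%:R^-1)%R].
  apply/seteqP; split => [x /= hx n _ /=|x hx /=].
    by apply: le_lt_trans hx _; rewrite ltrDl invr_gt0.
  apply/ler_addgt0Pr => e e0.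
  have [n ne] := exists_natSinv_lt e0.
  by have /= /ltW /le_trans := hx n I; apply; rewrite lerD2l ltW.
have cut_le t : cut [set x | (h x <= t)%R] by rewrite leE; exact: cut_bigcap.
have le_le t : (0 <= t)%R -> mu [set x | (h x <= t)%R] <= t%:E.
  move=> t0; apply/lee_addgt0Pr => e e0.
  apply: le_trans (lt_le (t + e)%R _); last by rewrite addr_ge0// ltW.
  apply: le_measure; rewrite ?inE; [exact: (cut_le _).1|exact: (cut_lt _).1|].
  by move=> x /= hx; apply: le_lt_trans hx _; rewrite ltrDl.
exists h; split => //.
- move=> x; apply/eqP; rewrite eq_le; apply/andP; split.
    by apply: le_le; have /andP[] := h01 x.
  (* Lower bound: [F n] contains some [V q] through x, whose measure is at least h x because h x is
     an infimum; [F n] decreases to {h <= h x}. *)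
  set F := fun n : nat => [set y | (h y < h x + n.+1%:R^-1)%R].
  have mF n : measurable (F n) by exact: (cut_lt _).1.
  have cF : (mu \o F) n @[n --> \oo] --> mu [set y | (h y <= h x)%R].
    rewrite leE; apply: nonincreasing_cvg_mu => //.
    - by rewrite ltey_eq fin_num_measure.
    - by apply: bigcapT_measurable.
    - move=> m n mn; apply/subsetPset => y /= /lt_le_trans; apply.
      by rewrite lerD2l lef_pV2 ?posrE// ler_nat.
  rewrite -(cvg_lim _ cF)//; apply: lime_ge.
    by apply/cvg_ex; eexists; exact: cF.
  apply: nearW => n /=.
  have /hltP[q Vqx qlt] : (h x < h x + n.+1%:R^-1)%R by rewrite ltrDl invr_gt0.
  apply: (@le_trans _ _ (mu (V q))).
    by rewrite -(fine_prob mu (mV q)) lee_fin; exact: h_le.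
  apply: le_measure; rewrite ?inE// => y Vqy /=.
  by apply/hltP; exists q.
(* The level u is mu U. For rational q between u and u + 1/(n+1), maximality puts U a.e. inside
   [V q], on which h < u + 1/(n+1). The other difference is null because mu {h <= u} <= u. *)
- move=> U cU; exists (fine (mu U)).
  have mU : measurable U by case: cU.
  have mL : measurable [set x | (h x <= fine (mu U))%R] by exact: (cut_le _).1.
  suff UL : mu (U `\` [set x | (h x <= fine (mu U))%R]) = 0.
    split => //; apply: measureD_eq0 => //.
    by rewrite -[leRHS](fine_prob mu mU); apply: le_le; exact: fine_ge0.
  apply/negligibleP; first exact: measurableD.
  rewrite leE setDE setC_bigcap setI_bigcupr; apply: negligible_bigcup => n.
  have ltU : (fine (mu U) < fine (mu U) + n.+1%:R^-1)%R.
    by rewrite ltrDl invr_gt0.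
  have [q] := rat_in_itvoo ltU; rewrite in_itv/= => /andP[Uq qU].
  have q0 : (0 <= q)%R.
    by rewrite -(@ler0q R) (le_trans _ (ltW Uq))//; exact: fine_ge0.
  apply: (@negligibleS _ _ _ _ (U `\` V q)).
    move=> y [Uy /= nh]; split => // Vqy; apply: nh; apply/hltP; exists q => //.
    apply: le_lt_trans qU; rewrite -lee_fin fine_prob//; exact: Vle.
  apply/negligibleP; first exact: measurableD.
  by apply: Vmax => //; rewrite -(fine_prob mu mU) lee_fin ltW.
Qed.

End cuts.

(** * Levels of the position function *)

Section levels.
Context {d : measure_display} {T : measurableType d} {R : realType}
  (mu : probability T R) (W : T -> T -> R)
  (hW : tournament_kernel [set: T] mu W) (h : T -> R) (hh : position mu W h).

Lemma position_bounds x : (0 <= h x <= 1)%R.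
Proof. by case: hh. Qed.

Lemma cut_position_lt t : cut mu W [set x | (h x < t)%R].
Proof. by case: hh => _ /(_ t)[]. Qed.

Lemma cut_position_le t : cut mu W [set x | (h x <= t)%R].
Proof. by case: hh => _ /(_ t)[]. Qed.

Lemma measurable_position_lt t : measurable [set x | (h x < t)%R].
Proof. by case: (cut_position_lt t). Qed.

Lemma measurable_position_le t : measurable [set x | (h x <= t)%R].
Proof. by case: (cut_position_le t). Qed.

Lemma position_levelE t :
  [set x | h x = t] = [set x | (h x <= t)%R] `\` [set x | (h x < t)%R].
Proof.
apply/seteqP; split => [x /= ->|x /= [hxt nh]]; first by rewrite ltxx lexx.
by apply/eqP; rewrite eq_le hxt leNgt; apply/negP.
Qed.

Lemma measurable_position_level t : measurable [set x | h x = t].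
Proof.
by rewrite position_levelE; apply: measurableD;
  [exact: measurable_position_le|exact: measurable_position_lt].
Qed.

Lemma measurable_position : measurable_fun [set: T] h.
Proof.
apply: (measurability _ (RGenInftyO.measurableE R)) => //.
move=> _ [_ [t ->] <-]; rewrite setTI.
have -> : h @^-1` `]-oo, t[%classic = [set x | (h x < t)%R].
  by apply/seteqP; split => x /=; rewrite in_itv.
exact: measurable_position_lt.
Qed.

Lemma measure_position_le x : mu [set y | (h y <= h x)%R] = (h x)%:E.
Proof. by case: hh. Qed.

(** A rational q between h x and h y makes the pair cross the cut {h < q}, and there are only
    countably many such cuts. *)
Lemma ae_position_lt_W1 :
  {ae mu \x mu, forall p : T * T, (h p.1 < h p.2)%R -> W p.1 p.2 = 1%R}.
Proof.
have : {ae mu \x mu, forall p : T * T, forall q : rat,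
    (h p.1 < ratr q)%R -> ~ (h p.2 < ratr q)%R -> W p.1 p.2 = 1%R}.
  by apply: ae_forall_countable => q; have [_] := cut_position_lt (ratr q).
apply: filterS => p hp /rat_in_itvoo[q]; rewrite in_itv/= => /andP[q1 q2].
by apply: (hp q) => //; apply/negP; rewrite -leNgt ltW.
Qed.

Lemma ae_position_gt_W0 :
  {ae mu \x mu, forall p : T * T, (h p.2 < h p.1)%R -> W p.1 p.2 = 0%R}.
Proof.
have [_ _ hS] := hW.
apply: filterS2 (ae_prod_swap ae_position_lt_W1) hS => p h1 h2 /h1 /= E.
have := h2 Logic.I Logic.I; rewrite E => /eqP.
by rewrite -subr_eq0 addrK => /eqP.
Qed.

(** Up to null sets U is some {h <= u}, which contains the level when t <= u and misses it
    otherwise. *)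
Lemma cut_level_zero_one t U : cut mu W U ->
  mu ([set x | h x = t] `&` U) = 0 \/ mu ([set x | h x = t] `\` U) = 0.
Proof.
move=> cU; have [mU _] := cU; have mL := measurable_position_level t.
have [u [Uu uU]] : exists u, mu (U `\` [set x | (h x <= u)%R]) = 0 /\
    mu ([set x | (h x <= u)%R] `\` U) = 0 by case: hh => _ _ _; apply.
have mu_ := measurable_position_le u.
have [tu|ut] := leP t u.
- right; apply: (subset_measure0 _ _ _ uU); [exact: measurableD..|].
  by move=> x [/= -> nU].
- left; apply: (subset_measure0 _ _ _ Uu).
  + exact: measurableI.
  + exact: measurableD.
  by move=> x [/= -> Ux]; split => //; apply/negP; rewrite -ltNge.
Qed.

(** The sets with this dichotomy form a sigma-algebra: complements exchange the alternatives, and a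
    union either has a member covering the level a.e. or has all its members meeting it in null
    sets. It contains the cuts, hence their differences. *)
Lemma sigmaZ_level_zero_one t E : sigmaZ mu W E ->
  mu ([set x | h x = t] `&` E) = 0 \/ mu ([set x | h x = t] `\` E) = 0.
Proof.
set L := [set x | h x = t].
have mL : measurable L by exact: measurable_position_level.
pose G := [set E | measurable E /\ (mu (L `&` E) = 0 \/ mu (L `\` E) = 0)].
suff : sigmaZ mu W `<=` G by move=> /(_ E) /[apply] -[].
have GC X : G X -> G (~` X).
  move=> [mX [X0|X0]]; (split; first exact: measurableC).
    by right; rewrite setDE setCK.
  by left; rewrite -setDE.
have GU (X : nat -> set T) : (forall n, G (X n)) -> G (\bigcup_n X n).
  move=> GX; have mX n : measurable (X n) by have [] := GX n.
  have mU : measurable (\bigcup_n X n) by exact: bigcupT_measurable.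
  split => //.
  have [[n Xn]|nX] := pselect (exists n, mu (L `\` X n) = 0).
    right; apply: (subset_measure0 _ _ _ Xn); [exact: measurableD..|].
    by move=> x [Lx nx]; split => // Xnx; apply: nx; exists n.
  left; apply/negligibleP; first exact: measurableI.
  rewrite setI_bigcupr; apply: negligible_bigcup => n.
  apply/negligibleP; first exact: measurableI.
  by have [_ []// Xn] := GX n; exfalso; apply: nX; exists n.
apply: smallest_sub.
  split => //; last by move=> X GX; rewrite setTD; exact: GC.
  by split=> //; left; rewrite setI0 measure0.
move=> A /Zfamily_cutD[B [U [cB cU ->]]].
have Gcut X : cut mu W X -> G X.
  by move=> cX; split; [case: cX|exact: cut_level_zero_one].
have -> : U `\` B = ~` (\bigcup_n (bigcup2 (~` U) B) n).
  by rewrite bigcup2E setCU setCK setDE.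
apply: (GC); apply: GU => -[|[|n]] /=; [exact/GC/Gcut|exact: Gcut|].
by split => //; left; rewrite setI0 measure0.
Qed.

Lemma sigmaZ_setI A B : sigmaZ mu W A -> sigmaZ mu W B -> sigmaZ mu W (A `&` B).
Proof. exact: (@measurableI _ (g_sigma_algebraType (Zfamily mu W))). Qed.

Lemma sigmaZ_setD A B : sigmaZ mu W A -> sigmaZ mu W B -> sigmaZ mu W (A `\` B).
Proof. exact: (@measurableD _ (g_sigma_algebraType (Zfamily mu W))). Qed.

Lemma sigmaZ_level t : sigmaZ mu W [set x | h x = t].
Proof.
rewrite position_levelE; apply: sigmaZ_setD; apply: sigmaZ_cut.
  exact: cut_position_le.
exact: cut_position_lt.
Qed.

Lemma atom_level t : 0 < mu [set x | h x = t] ->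
  atom (sigmaZ mu W) mu [set x | h x = t].
Proof.
move=> t0; split => //; first exact: sigmaZ_level.
move=> [A [sA AL /andP[A0 AltL]]].
have mL := measurable_position_level t; have mA := sigmaZ_measurable sA.
have := probDI mu mL mA.
have [LA|LA] := sigmaZ_level_zero_one t sA.
  by move: A0; rewrite -(setIidr AL) LA ltxx.
by rewrite LA add0e setIidr// => E; move: AltL; rewrite E ltxx.
Qed.

(* sup {t | mu (A `&` {h < t}) = 0} is the only level that A can sit on. *)
Lemma zero_one_level (A : set T) : measurable A ->
  (forall t, mu (A `&` [set x | (h x < t)%R]) = 0 \/
             mu (A `\` [set x | (h x < t)%R]) = 0) ->
  exists t, mu (A `\` [set x | h x = t]) = 0.
Proof.
move=> mA A01.
(* For null [A] the set [X] below would be all of R, without a supremum. *)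
have [A0|A0] := eqVneq (mu A) 0.
  exists 0%R; apply: (subset_measure0 _ mA _ A0) => //.
  by apply: measurableD => //; exact: measurable_position_level.
pose X := [set t | mu (A `&` [set x | (h x < t)%R]) = 0].
have X0 : X 0%R.
  rewrite /X /= -[RHS](@measure0 _ _ _ mu); congr (mu _).
  apply/seteqP; split => x // [_ /=].
  by have /andP[] := position_bounds x; case: ltP.
have Xub t : X t -> (t <= 1)%R.
  rewrite leNgt => Xt; apply/negP => t1; move/eqP: A0; apply.
  rewrite -[RHS]Xt; congr (mu _); apply/seteqP; split => x; last by case.
  by split => //=; apply: le_lt_trans t1; have /andP[] := position_bounds x.
have hX : has_sup X by split; [exists 0%R|exists 1%R => t; exact: Xub].
exists (sup X); apply/negligibleP.
  by apply: measurableD => //; exact: measurable_position_level.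
(* A point off the level [sup X] is below or above it by more than some 1/(n+1). Below, an element
   of [X] close to the supremum gives a null set; above, [sup X + 1/(n+1)] is not in [X], so the
   second alternative of the hypothesis holds. *)
apply: (@negligibleS _ _ _ _
  ((\bigcup_n (A `&` [set x | (h x < sup X - n.+1%:R^-1)%R])) `|`
   (\bigcup_n (A `\` [set x | (h x < sup X + n.+1%:R^-1)%R])))).
  move=> x [Ax /= /eqP]; rewrite neq_lt -subr_gt0 -[X in _ || X]subr_gt0.
  case/orP => /exists_natSinv_lt[n nx].
    left.
    by exists n => //; split => //=; rewrite ltrBrDl -ltrBrDr.
  right; exists n => //; split => //=; apply/negP; rewrite -leNgt.
  by rewrite addrC -lerBrDr ltW.
have mlt := measurable_position_lt.
apply: negligibleU; apply: negligible_bigcup => n.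
- apply/negligibleP; first exact: measurableI.
  have n0 : (0 < n.+1%:R^-1 :> R)%R by rewrite invr_gt0 ltr0n.
  have [t Xt nt] := sup_adherent n0 hX.
  apply: (subset_measure0 _ _ _ Xt); [exact: measurableI..|].
  by move=> x [Ax /= hx]; split => //=; exact: lt_trans nt.
- apply/negligibleP; first exact: measurableD.
  have [Xn|//] := A01 (sup X + n.+1%:R^-1)%R; exfalso.
  have := ub_le_sup hX.2 Xn.
  by rewrite gerDl leNgt invr_gt0 ltr0n.
Qed.

Lemma atom_zero_one (A E : set T) : atom (sigmaZ mu W) mu A -> sigmaZ mu W E ->
  mu (A `&` E) = 0 \/ mu (A `\` E) = 0.
Proof.
move=> [sA A0 nA] sE.
have mA := sigmaZ_measurable sA; have mE := sigmaZ_measurable sE.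
have [AE0|AE0] := eqVneq (mu (A `&` E)) 0; [by left|right].
have mAE := measurableI _ _ mA mE; have mAD := measurableD mA mE.
have : ~ (mu (A `&` E) < mu A).
  move=> lt; apply: nA; exists (A `&` E); split.
  - exact: sigmaZ_setI.
  - exact: subIsetl.
  - by rewrite lt andbT lt_neqAle eq_sym AE0/=.
move/negP; rewrite -leNgt -(fine_prob mu mA) -(fine_prob mu mAE) lee_fin.
rewrite (fine_probDI mu mA mE) => le.
rewrite -(fine_prob mu mAD); congr EFin.
have := fine_ge0 (measure_ge0 mu (A `\` E)); lra.
Qed.

(** The dichotomy is used both ways: for A against the cuts {h < t}, to put A on one level, then for
    that level against A, to leave nothing of the level outside A. *)
Lemma atom_eq_level (A : set T) : atom (sigmaZ mu W) mu A ->
  exists t, mu (A `\` [set x | h x = t]) = 0 /\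
            mu ([set x | h x = t] `\` A) = 0.
Proof.
move=> aA; have [sA A0 _] := aA; have mA := sigmaZ_measurable sA.
have [|t At] := zero_one_level mA.
  move=> t; apply: atom_zero_one => //.
  by apply: sigmaZ_cut; exact: cut_position_lt.
exists t; split => //; have [LA|//] := sigmaZ_level_zero_one t sA; exfalso.
have := probDI mu mA (measurable_position_level t).
by rewrite At setIC LA add0e => E; move: A0; rewrite E ltxx.
Qed.

End levels.

(** * Atoms and the nonatomic part *)

Section decomposition.
Context {d : measure_display} {T : measurableType d} {R : realType}
  (mu : probability T R) (W : T -> T -> R)
  (hW : tournament_kernel [set: T] mu W) (h : T -> R) (hh : position mu W h)
  {Q : countType} (S : Q -> set T)
  (hS : atom_enumeration (sigmaZ mu W) mu S).

Lemma measurable_atom i : measurable (S i).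
Proof. by have [/(_ i)[+ _ _] _ _] := hS; exact: sigmaZ_measurable. Qed.

Lemma atom_gt0 i : 0 < mu (S i).
Proof. by have [/(_ i)[]] := hS. Qed.

Lemma fine_atom_gt0 i : (0 < fine (mu (S i)))%R.
Proof.
by rewrite -lte_fin fine_prob ?atom_gt0//; exact: measurable_atom.
Qed.

Lemma atom_index_inj i j x : S i x -> S j x -> i = j.
Proof. by have [_ tS _] := hS; move=> Si Sj; apply: tS => //; exists x. Qed.

Lemma measurable_nonatomic : measurable (nonatomic_part S).
Proof.
apply: measurableC; apply: countable_bigcupT_measurable => //.
exact: measurable_atom.
Qed.

Lemma nonatomic_partN i x : nonatomic_part S x -> ~ S i x.
Proof. by move=> nx Sx; apply: nx; exists i. Qed.

Lemma nonatomic_or_atom x : nonatomic_part S x \/ exists i, S i x.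
Proof.
have [[i Si]|nS] := pselect (exists i, S i x); [by right; exists i|left].
by move=> [i _ Si]; apply: nS; exists i.
Qed.

(** A level of positive measure is an atom, hence a.e. equal to some [S i], which is disjoint from
    the nonatomic part. *)
Lemma nonatomic_level t : mu (nonatomic_part S `&` [set x | h x = t]) = 0.
Proof.
have mL := measurable_position_level hh t; have mI := measurable_nonatomic.
have mIL := measurableI _ _ mI mL.
have [L0|L0] := eqVneq (mu [set x | h x = t]) 0.
  exact: (subset_measure0 _ mL _ L0).
have /atom_level : 0 < mu [set x | h x = t] by rewrite lt_neqAle eq_sym L0/=.
move/(_ _ hh); have [_ _ /[apply]] := hS; move=> [i].
apply: subset_measure0 => //; have mSi := measurable_atom i.
  by apply: measurableU; exact: measurableD.
by move=> x [Ix Lx]; left; split => //; exact: nonatomic_partN.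
Qed.

Lemma ae_nonatomic_neq t : {ae mu, forall x, nonatomic_part S x -> h x <> t}.
Proof.
have mIL := measurableI _ _ measurable_nonatomic (measurable_position_level hh t).
by apply: filterS (ae_notin mIL (nonatomic_level t)) => x nx Ix ht; apply: nx.
Qed.

(** Tonelli: the section of [N] at x is the part of the level of h x in the nonatomic part. *)
Lemma ae_nonatomic_pair_neq : {ae mu \x mu, forall p : T * T,
  nonatomic_part S p.1 -> nonatomic_part S p.2 -> h p.1 <> h p.2}.
Proof.
have mI := measurable_nonatomic; have mh := measurable_position hh.
pose N := [set p : T * T | nonatomic_part S p.2] `&` [set p | h p.1 = h p.2].
have mN : measurable N.
  apply: measurableI.
    by rewrite (_ : [set p | _] = setT `*` nonatomic_part S);
      [exact: measurableX|apply/seteqP; split => x //= []].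
  rewrite (_ : [set p | _] =
      (fun p : T * T => h p.1 - h p.2)%R @^-1` [set 0%R]).
    rewrite -[X in measurable X]setTI.
    have mf : measurable_fun setT (fun p : T * T => h p.1 - h p.2)%R.
      by apply: measurable_funB; exact: measurableT_comp.
    by apply: mf => //; exact: measurable_set1.
  apply/seteqP; split => p /=; first by move=> ->; rewrite subrr.
  by move/eqP; rewrite subr_eq0 => /eqP.
suff N0 : (mu \x mu) N = 0.
  by exists N; split => // p /= /not_implyP[_ /not_implyP[I2 /contrapT]].
apply/product_measure_eq0P => //; apply: aeW => x.
rewrite -[RHS](nonatomic_level (h x)); congr (mu _).
by apply/seteqP; split => y; rewrite /xsection /N/= inE/= => -[].
Qed.

Lemma exists_atom_position : exists t : Q -> R, forall i,
  mu (S i `\` [set x | h x = t i]) = 0 /\ mu ([set x | h x = t i] `\` S i) = 0.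
Proof.
have [aS _ _] := hS.
have [t ht] := choice (fun i => atom_eq_level hh (aS i)).
by exists t.
Qed.

Context (t : Q -> R) (ht : forall i,
  mu (S i `\` [set x | h x = t i]) = 0 /\ mu ([set x | h x = t i] `\` S i) = 0).

Lemma ae_atom_position : {ae mu, forall x, forall i, S i x <-> h x = t i}.
Proof.
apply: ae_forall_countable => i; have [h1 h2] := ht i.
have mS := measurable_atom i; have mL := measurable_position_level hh (t i).
apply: filterS2 (ae_notin (measurableD mS mL) h1)
  (ae_notin (measurableD mL mS) h2).
move=> x n1 n2; split => [Sx|hx]; apply: contrapT => nx.
  exact: n1.
exact: n2.
Qed.

Lemma measure_atom_position i : mu [set x | h x = t i] = mu (S i).
Proof.
apply: ae_measure_eq.
- exact: (measurable_position_level hh).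
- exact: measurable_atom.
- by apply: filterS ae_atom_position => x /(_ i)[]; split.
Qed.

Lemma atom_position_inj : injective t.
Proof.
move=> i j tij.
have [x Sx hx] := ae_exists (measurable_atom i) (atom_gt0 i) ae_atom_position.
by apply: (atom_index_inj Sx); apply/hx; rewrite -tij; apply/hx.
Qed.

Lemma measure_le_atom_position i : mu [set x | (h x <= t i)%R] = (t i)%:E.
Proof.
have [x Sx hx] := ae_exists (measurable_atom i) (atom_gt0 i) ae_atom_position.
by rewrite -((hx i).1 Sx); exact: (measure_position_le hh).
Qed.

(** Removing the level, of measure mu(S_i), from {h <= t_i}, of measure t_i. This is the value that
    [eta_inl] finds for eta(i). *)
Lemma measure_lt_atom_position i :
  fine (mu [set x | (h x < t i)%R]) = (t i - fine (mu (S i)))%R.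
Proof.
have := fine_probDI mu (measurable_position_le hh (t i))
  (measurable_position_lt hh (t i)).
rewrite -position_levelE// measure_atom_position measure_le_atom_position /=.
rewrite setIidr => [tE|x /= /ltW//]; lra.
Qed.

(** The gap below an atom: {h <= h x}, of measure h x, lies inside {h < t_i}. *)
Lemma position_le_lt_atom x i : (h x < t i)%R ->
  (h x <= t i - fine (mu (S i)))%R.
Proof.
move=> hx; rewrite -measure_lt_atom_position -lee_fin fine_prob; last first.
  exact: (measurable_position_lt hh).
rewrite -(measure_position_le hh); apply: le_measure; rewrite ?inE.
- exact: (measurable_position_le hh).
- exact: (measurable_position_lt hh).
- by move=> y /= hy; exact: le_lt_trans hx.
Qed.

Lemma ae_section_W : {ae mu, forall x, {ae mu, forall y,
  ((h x < h y)%R -> W x y = 1%R) /\ ((h y < h x)%R -> W x y = 0%R)}}.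
Proof.
apply: (@ae_prod_xsection _ _ _ _ _ mu mu (fun p =>
  ((h p.1 < h p.2)%R -> W p.1 p.2 = 1%R) /\
  ((h p.2 < h p.1)%R -> W p.1 p.2 = 0%R))).
exact: filterI (ae_position_lt_W1 hh) (ae_position_gt_W0 hW hh).
Qed.

Lemma measurable_kernel : measurable_fun [set: T * T] (fun p => W p.1 p.2).
Proof. by have [+ _ _] := hW; rewrite setXTT. Qed.

Lemma measurable_kernel_section x : measurable_fun [set: T] (W x).
Proof.
have mx : measurable_fun [set: T] (fun y => (x, y)).
  by apply: measurable_fun_pair.
exact: (measurableT_comp measurable_kernel mx).
Qed.

(** Turns membership of j in [dominated_atoms] at x into nullity of a section, a condition
    measurable in x. *)
Definition non_dominated j : set (T * T) :=
  [set p | S j p.2 /\ W p.1 p.2 <> 1%R].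

Lemma measurable_non_dominated j : measurable (non_dominated j).
Proof.
rewrite (_ : non_dominated j =
  (setT `*` S j) `&` (fun p => W p.1 p.2) @^-1` ~` [set 1%R]).
  apply: measurableI; first by apply: measurableX => //; exact: measurable_atom.
  rewrite -[X in measurable X]setTI; apply: measurable_kernel => //.
  by apply: measurableC; exact: measurable_set1.
by apply/seteqP; split => p /= [] // [].
Qed.

Lemma dominated_atomsP x j :
  dominated_atoms mu W S x j <-> mu (xsection (non_dominated j) x) = 0.
Proof.
have mx := measurable_xsection x (measurable_non_dominated j).
have E : ~` [set y | S j y -> W x y = 1%R] = xsection (non_dominated j) x.
  apply/seteqP; split => y /=; rewrite /xsection /non_dominated /= inE/=.
    by move/not_implyP.
  by move=> [? ?]; apply/not_implyP.
by rewrite /dominated_atoms /= -(negligibleP mu mx) -E.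
Qed.

(* On the set X of the x in S i that dominate S i, both W x y = 1 and
   W y x = 1 hold a.e., so X is null. *)
Lemma ae_not_dominated_self :
  {ae mu, forall x, forall i, S i x -> ~ dominated_atoms mu W S x i}.
Proof.
apply: ae_forall_countable => i.
have mE := measurable_non_dominated i.
pose X := S i `&` [set x | mu (xsection (non_dominated i) x) = 0].
have mX : measurable X.
  apply: measurableI; first exact: measurable_atom.
  rewrite (_ : [set x | _] =
      (mu \o xsection (non_dominated i)) @^-1` [set 0])//.
  rewrite -[X in measurable X]setTI.
  by apply: (measurable_fun_xsection mu mE) => //; exact: emeasurable_set1.
suff X0 : mu X = 0.
  apply: filterS (ae_notin mX X0) => x nX Sx /dominated_atomsP dx.
  by apply: nX.
have mN : measurable (non_dominated i `&` (X `*` X)).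
  by apply: measurableI => //; exact: measurableX.
have N0 : (mu \x mu) (non_dominated i `&` (X `*` X)) = 0.
  apply/product_measure_eq0P => //; apply: aeW => x.
  have [Xx|nXx] := pselect (X x).
    apply: (subset_measure0 _ _ _ Xx.2); [exact: measurable_xsection..|].
    by apply: le_xsection; exact: subIsetl.
  rewrite -[RHS](@measure0 _ _ _ mu); congr (mu _).
  by apply/seteqP; split => y //; rewrite /xsection/= inE => -[_ []].
have X1 : {ae mu \x mu, forall p : T * T, X p.1 -> X p.2 -> W p.1 p.2 = 1%R}.
  exists (non_dominated i `&` (X `*` X)); split => //.
  move=> p /= /not_implyP[X1 /not_implyP[X2 nW]]; split => //.
  by split => //; case: X2.
have [_ _ hSym] := hW.
suff : (mu \x mu) (X `*` X) = 0.
  by rewrite product_measure1E// => /eqP; rewrite mule_eq0 orbb => /eqP.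
apply/negligibleP; first exact: measurableX.
apply: negligibleS (_ : (mu \x mu).-negligible
  (~` [set p | ~ (X p.1 /\ X p.2)])).
  by move=> p [? ?] /=; exact.
apply: filterS3 X1 (ae_prod_swap X1) hSym => p h1 h2 h3 [X1 X2].
have := h3 Logic.I Logic.I; rewrite (h1 X1 X2) (h2 X2 X1) => /eqP.
by apply/negP; rewrite neq_lt; apply/orP; right; lra.
Qed.

End decomposition.

(** * The map eta *)

Section eta.
Context {d : measure_display} {T : measurableType d} {R : realType}
  (mu : probability T R) (W : T -> T -> R)
  (hW : tournament_kernel [set: T] mu W)
  {Q : countType} (S : Q -> set T)
  (hS : atom_enumeration (sigmaZ mu W) mu S).

Let mI := measurable_nonatomic hS.
Let mS := measurable_atom hS.

Lemma measurable_EFin_kernel_section (D : set T) x :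
  measurable_fun D (fun y => (W x y)%:E).
Proof.
apply/measurable_EFinP; apply: measurable_funTS.
exact: (measurable_kernel_section hW).
Qed.

Lemma kernel_bounds x y : (0 <= W x y <= 1)%R.
Proof. by have [_ + _] := hW; exact. Qed.

Lemma measure_bigcup_atoms (D : set Q) :
  mu (\bigcup_(j in D) S j) = \esum_(j in D) mu (S j).
Proof.
apply: measure_bigcup_countable => //.
by have [_ + _] := hS; exact: sub_trivIset.
Qed.

Lemma measurable_bigcup_atoms (D : set Q) : measurable (\bigcup_(j in D) S j).
Proof.
rewrite bigcup_mkcond; apply: countable_bigcupT_measurable => // j.
by case: ifP.
Qed.

Lemma measure_nonatomicU_atoms (A : set T) (D : set Q) : measurable A ->
  A `<=` nonatomic_part S ->
  mu (A `|` \bigcup_(j in D) S j) = mu A + \esum_(j in D) mu (S j).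
Proof.
move=> mA AI; rewrite -measure_bigcup_atoms measureU//.
  exact: measurable_bigcup_atoms.
apply/seteqP; split => x // [/AI Ix [j _ Sj]].
exact: (nonatomic_partN Ix Sj).
Qed.

Lemma Lambda_ge0 x : 0 <= Lambda mu W S x.
Proof.
apply: adde_ge0; last by apply: esum_ge0.
apply: integral_ge0 => y _; rewrite lee_fin.
by have /andP[] := kernel_bounds x y.
Qed.

Lemma Lambda_le1 x : Lambda mu W S x <= 1.
Proof.
apply: (@le_trans _ _ (mu (nonatomic_part S `|`
    \bigcup_(j in dominated_atoms mu W S x) S j))); last first.
  apply: probability_le1; apply: measurableU => //.
  exact: measurable_bigcup_atoms.
rewrite measure_nonatomicU_atoms//; apply: leeD => //.
rewrite -[leRHS]mul1e -integral_cst//; apply: ge0_le_integral => //.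
- by move=> y _; rewrite lee_fin; have /andP[] := kernel_bounds x y.
- exact: measurable_EFin_kernel_section.
- by move=> y _; rewrite lee_fin; have /andP[] := kernel_bounds x y.
Qed.

Lemma Lambda_fin_num x : Lambda mu W S x \is a fin_num.
Proof.
rewrite ge0_fin_numE; last exact: Lambda_ge0.
by apply: le_lt_trans (Lambda_le1 x) _; exact: ltry.
Qed.

(** The integral is a Tonelli integral with the indicator of the nonatomic part inside; in the sum,
    each term is mu(S_j) times the indicator of the x that dominate S_j. *)
Lemma measurable_Lambda : measurable_fun [set: T] (Lambda mu W S).
Proof.
apply: emeasurable_funD.
  pose f (p : T * T) := ((W p.1 p.2)%:E * (\1_(nonatomic_part S) p.2)%:E).
  rewrite (_ : (fun x => _) = fubini_F mu f); last first.
    apply/funext => x; rewrite /fubini_F [LHS]integral_mkcond.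
    apply: eq_integral => y _; rewrite /f patchE indicE /=.
    by case: ifP => _; rewrite ?mule1 ?mule0.
  apply: measurable_fun_fubini_tonelli_F => [|p].
    apply: emeasurable_funM; apply/measurable_EFinP.
      exact: (measurable_kernel hW).
    by apply: measurableT_comp.
  by rewrite mule_ge0// lee_fin; have /andP[] := kernel_bounds p.1 p.2.
under eq_fun do rewrite esum_countable//.
rewrite (_ : (fun x => _) = (fun x => \sum_(i <oo | i \in xpredT)
  (if pickle_inv i is Some j then
    if j \in dominated_atoms mu W S x then mu (S j) else 0 else 0))); last first.
  by apply/funext => x; apply: eq_eseriesl => n.
apply: ge0_emeasurable_sum.
  by move=> k x _ _; case: pickle_inv => // j; case: ifP.
move=> k _; case: pickle_inv => [j|]; last exact: measurable_cst.
pose X := [set x | mu (xsection (non_dominated W S j) x) = 0].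
have mX : measurable X.
  rewrite (_ : X = (mu \o xsection (non_dominated W S j)) @^-1` [set 0])//.
  rewrite -[Y in measurable Y]setTI.
  apply: (measurable_fun_xsection mu (measurable_non_dominated hW hS j)) => //.
rewrite (_ : (fun x => _) = (fun x => mu (S j) * (\1_X x)%:E)).
  by apply: measurable_funeM; apply/measurable_EFinP.
apply/funext => x; rewrite indicE.
have -> : (j \in dominated_atoms mu W S x) = (x \in X).
  by apply/idP/idP => /set_mem /(dominated_atomsP hW hS) ?; exact/mem_set.
by case: ifP; rewrite ?mule1 ?mule0.
Qed.

Context (h : T -> R) (hh : position mu W h) (t : Q -> R) (ht : forall i,
  mu (S i `\` [set x | h x = t i]) = 0 /\ mu ([set x | h x = t i] `\` S i) = 0).

Lemma ae_Lambda : {ae mu, forall x, Lambda mu W S x = (1 - h x)%:E}.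
Proof.
apply: filterS3 (ae_atom_position hh hS ht) (ae_section_W hW hh)
  (ae_not_dominated_self hW hS) => x xS xW xD.
have mgt : measurable [set y | (h x < h y)%R].
  rewrite (_ : [set y | _] = ~` [set y | (h y <= h x)%R]).
    by apply: measurableC; exact: (measurable_position_le hh).
  by apply/seteqP; split => y /=; rewrite ltNge => /negP.
(* If t_j = h x, then x is in S_j and would dominate its own atom; if t_j < h x, then W x y = 0 at a
   typical y of S_j. *)
have dE : dominated_atoms mu W S x = [set j | (h x < t j)%R].
  apply/seteqP; split => j /=; last first.
    move=> hxj; apply: filterS2 xW (ae_atom_position hh hS ht) => y [+ _] yS Sy.
    by apply; rewrite ((yS j).1 Sy).
  move=> dj; rewrite ltNge le_eqVlt; apply/negP => /orP[/eqP tj|tj].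
    by apply: (xD j) => //; apply/xS.
  have [y Sy [yS [[_ y0] y1]]] := ae_exists (mS j) (atom_gt0 hS j)
    (filterI (ae_atom_position hh hS ht) (filterI xW dj)).
  have := y1 Sy; rewrite y0; last by rewrite ((yS j).1 Sy).
  by move/eqP; rewrite eq_sym oner_eq0.
rewrite /Lambda dE.
have -> : \int[mu]_(y in nonatomic_part S) (W x y)%:E =
    mu ([set y | (h x < h y)%R] `&` nonatomic_part S).
  rewrite -integral_indic//; apply: ge0_ae_eq_integral => //.
  - exact: measurable_EFin_kernel_section.
  - by apply/measurable_EFinP; exact: measurable_indic.
  - by move=> y _; rewrite lee_fin; have /andP[] := kernel_bounds x y.
  apply: filterS2 xW (ae_nonatomic_neq hh hS (h x)) => y [y1 y0] yn Iy.
  have [lt|lt|/esym /(yn Iy)//] := ltgtP (h x) (h y).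
    by rewrite y1// indicE mem_set.
  by rewrite y0// indicE memNset//= ltNge ltW.
rewrite -measure_nonatomicU_atoms; [|exact: measurableI|exact: subIsetr].
(* The nonatomic points above x and the atoms above x make up {h > h x} a.e. *)
rewrite (_ : mu _ = mu [set y | (h x < h y)%R]); last first.
  apply: ae_measure_eq => //.
    apply: measurableU; first exact: measurableI.
    exact: measurable_bigcup_atoms.
  apply: filterS (ae_atom_position hh hS ht) => y yS.
  split => [[[]//|[j /= hj Sj]]|hy].
    by rewrite /= ((yS j).1 Sj).
  have [Iy|[j Sj]] := nonatomic_or_atom S y; first by left.
  by right; exists j => //=; rewrite -((yS j).1 Sj).
rewrite (_ : [set y | _] = ~` [set y | (h y <= h x)%R]).
  rewrite probability_setC ?(measure_position_le hh)//.
  exact: (measurable_position_le hh).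
by apply/seteqP; split => y /=; rewrite ltNge => /negP.
Qed.

Lemma ae_eta_inr : {ae mu, forall x, eta_map mu W S (inr x) = h x}.
Proof. by apply: filterS ae_Lambda => x /= ->; rewrite /= opprB addrC subrK. Qed.

(** Lambda is a.e. the constant 1 - t_i on S_i, so averaging over S_i returns this constant. *)
Lemma eta_inl i : eta_map mu W S (inl i) = (t i - fine (mu (S i)))%R.
Proof.
rewrite /eta_map.
have -> : \int[mu]_(x in S i) Lambda mu W S x =
    \int[mu]_(x in S i) cst (1 - t i)%:E x.
  apply: ae_eq_integral => //.
    by apply: measurable_funTS; exact: measurable_Lambda.
  apply: filterS2 ae_Lambda (ae_atom_position hh hS ht) => x -> xS Sx.
  by rewrite ((xS i).1 Sx).
rewrite integral_cst// fineM ?fin_num_measure//=.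
have := fine_atom_gt0 hS i; set a := fine _ => a0.
have -> : (a^-1 * ((1 - t i) * a) = 1 - t i)%R.
  by rewrite mulrC mulfK// gt_eqF.
lra.
Qed.

Lemma eta_inl_bounds i : (0 <= eta_map mu W S (inl i) <= 1)%R.
Proof.
rewrite eta_inl -(measure_lt_atom_position hh hS ht).
rewrite fine_ge0//= -lee_fin fine_prob ?probability_le1//;
  exact: (measurable_position_lt hh).
Qed.

Lemma eta_inr_bounds x : (0 <= eta_map mu W S (inr x) <= 1)%R.
Proof.
rewrite /eta_map; have := Lambda_ge0 x; have := Lambda_le1 x.
rewrite -[Lambda _ _ _ x]fineK ?Lambda_fin_num//= !lee_fin => ? ?.
by apply/andP; split; lra.
Qed.

(** If t_i < t_j, the gap below atom j gives eta(i) < t_i <= t_j - mu(S_j) = eta(j). *)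
Lemma eta_inl_inj : injective (fun i => eta_map mu W S (inl i)).
Proof.
have lt_eta i j : (t i < t j)%R ->
    (eta_map mu W S (inl i) < eta_map mu W S (inl j))%R.
  have [x Sx hx] := ae_exists (mS i) (atom_gt0 hS i)
    (ae_atom_position hh hS ht).
  rewrite !eta_inl -((hx i).1 Sx) => /(position_le_lt_atom hh hS ht).
  by have := fine_atom_gt0 hS i; lra.
move=> i j ij; have E : eta_map mu W S (inl i) = eta_map mu W S (inl j) := ij.
apply: (atom_position_inj hh hS ht).
by have [/lt_eta|/lt_eta|//] := ltgtP (t i) (t j); rewrite E ltxx.
Qed.

(** The interval is [t_i - mu(S_i), t_i): the gap excludes its interior, and its left endpoint is a
    level, null in the nonatomic part. *)
Lemma ae_eta_avoid : {ae mu, forall x, nonatomic_part S x -> forall i,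
  ~ (eta_map mu W S (inl i) <= eta_map mu W S (inr x)
       < eta_map mu W S (inl i) + fine (mu (S i)))%R}.
Proof.
have aeN : {ae mu, forall x, forall i, nonatomic_part S x ->
    h x <> (t i - fine (mu (S i)))%R}.
  by apply: ae_forall_countable => i; exact: (ae_nonatomic_neq hh hS).
apply: filterS2 ae_eta_inr aeN => x -> xN Ix i.
rewrite eta_inl subrK => /andP[le /(position_le_lt_atom hh hS ht) ge].
by apply: (xN i Ix); apply/eqP; rewrite eq_le ge.
Qed.

Lemma dsum_eta_atom i x : S i x ->
  dsum_eta S (eta_map mu W S) x = eta_map mu W S (inl i).
Proof.
move=> Si; rewrite /dsum_eta; case: pselect => [ex|]; last by case; exists i.
by case: (cid ex) => j Sj /=; rewrite (atom_index_inj hS Sj Si).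
Qed.

Lemma dsum_eta_nonatomic x : nonatomic_part S x ->
  dsum_eta S (eta_map mu W S) x = eta_map mu W S (inr x).
Proof.
move=> Ix; rewrite /dsum_eta; case: pselect => [[i Si]|//].
by exfalso; exact: (nonatomic_partN Ix Si).
Qed.

(** Passing from h to eta lowers x or leaves it in place, which is harmless. When y is in S_j, it
    moves down to t_j - mu(S_j), still at least h x by the gap; strictness comes from mu(S_i) > 0 if
    x is in an atom, and otherwise from h x avoiding that endpoint. *)
Lemma ae_dsum_eta_lt : {ae mu \x mu, forall p : T * T, (h p.1 < h p.2)%R ->
  (dsum_eta S (eta_map mu W S) p.1 < dsum_eta S (eta_map mu W S) p.2)%R}.
Proof.
pose good x := [/\ forall i, S i x <-> h x = t i,
  nonatomic_part S x -> eta_map mu W S (inr x) = h x &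
  forall i, nonatomic_part S x -> h x <> (t i - fine (mu (S i)))%R].
have ae_good : {ae mu, forall x, good x}.
  have aeN : {ae mu, forall x, forall i, nonatomic_part S x ->
      h x <> (t i - fine (mu (S i)))%R}.
    by apply: ae_forall_countable => i; exact: (ae_nonatomic_neq hh hS).
  apply: filterS3 (ae_atom_position hh hS ht) ae_eta_inr aeN => x ? ? ?.
  by split.
apply: filterS2 (ae_prod_fst mu ae_good) (ae_prod_snd mu ae_good).
move=> [x y] /= [xS xe xn] [yS ye _] hxy.
have xcase : (dsum_eta S (eta_map mu W S) x < h x)%R \/
    nonatomic_part S x /\ dsum_eta S (eta_map mu W S) x = h x.
  have [Ix|[i Si]] := nonatomic_or_atom S x.
    by right; rewrite dsum_eta_nonatomic// xe.
  left; rewrite (dsum_eta_atom Si) eta_inl ((xS i).1 Si).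
  by have := fine_atom_gt0 hS i; lra.
have [Iy|[j Sj]] := nonatomic_or_atom S y.
  rewrite (dsum_eta_nonatomic Iy) ye//.
  by case: xcase => [/lt_trans|[_ ->]]; last done; apply.
rewrite (dsum_eta_atom Sj) eta_inl.
have := hxy; rewrite ((yS j).1 Sj) => /(position_le_lt_atom hh hS ht) le.
case: xcase => [/lt_le_trans|[Ix ->]]; first exact.
by rewrite lt_neqAle le andbT; apply/eqP; exact: xn.
Qed.

(** A.e. pair with equal h lies in one atom, so the tie value of [dsum_kernel] occurs only on a null
    set; the other pairs are ordered alike by h and eta. *)
Lemma ae_kernel_eq : {ae mu \x mu, forall p : T * T,
  W p.1 p.2 = dsum_kernel S (fun=> W) (eta_map mu W S) p.1 p.2}.
Proof.
have ae_neq : {ae mu \x mu, forall p : T * T,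
    ~ (exists i, S i p.1 /\ S i p.2) -> h p.1 <> h p.2}.
  have aeS := ae_atom_position hh hS ht.
  apply: filterS3 (ae_nonatomic_pair_neq hh hS) (ae_prod_fst mu aeS)
    (ae_prod_snd mu aeS) => -[x y] /= xyI xS yS nxy hxy.
  have [Ix|[i Si]] := nonatomic_or_atom S x; last first.
    apply: nxy; exists i; split => //; apply/yS; rewrite -hxy; exact/xS.
  have [Iy|[i Si]] := nonatomic_or_atom S y; first exact: xyI.
  by apply: nxy; exists i; split => //; apply/xS; rewrite hxy; exact/yS.
have ae_lt := ae_dsum_eta_lt; have ae_gt := ae_prod_swap ae_lt.
have ae_W : {ae mu \x mu, forall p : T * T,
    ((h p.1 < h p.2)%R -> W p.1 p.2 = 1%R) /\
    ((h p.2 < h p.1)%R -> W p.1 p.2 = 0%R)}.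
  apply: filterS2 (ae_position_lt_W1 hh) (ae_position_gt_W0 hW hh) => p.
  by split.
have ae_eta : {ae mu \x mu, forall p : T * T,
    ((h p.1 < h p.2)%R -> (dsum_eta S (eta_map mu W S) p.1
       < dsum_eta S (eta_map mu W S) p.2)%R) /\
    ((h p.2 < h p.1)%R -> (dsum_eta S (eta_map mu W S) p.2
       < dsum_eta S (eta_map mu W S) p.1)%R)}.
  by apply: filterS2 ae_lt ae_gt => p; split.
apply: filterS3 ae_neq ae_eta ae_W => -[x y] /= nxy [lt gt] [W1 W0].
rewrite /dsum_kernel; case: pselect => [//|/nxy neq].
have [hlt|hlt|//] := ltgtP (h x) (h y).
  by rewrite lt// W1.
by rewrite ltNge ltW ?gt//= W0.
Qed.

End eta.

(** * Conditional probabilities and their null sets *)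

Section conditional_probabilities.
Context {d : measure_display} {T : measurableType d} {R : realType}
  (mu : probability T R).

Lemma cond_probE (A B : set T) : measurable A -> 0 < mu A ->
  cond_prob mu A B = mu (B `&` A) / mu A.
Proof.
move=> mA A0; rewrite /cond_prob; case: pselect => // mA'.
rewrite /= /mnormalize /= /mrestr setTI gt_eqF//= ifF; last first.
  by apply/negP => /eqP; apply/eqP; rewrite -ltey ltey_eq fin_num_measure.
congr (_ * _); rewrite -[in RHS](fine_prob mu mA) inver ifF//.
by apply/negP => /eqP E; move: A0; rewrite -(fine_prob mu mA) E ltxx.
Qed.

Lemma cond_probE0 (A : set T) : mu A = 0 ->
  cond_prob mu A = mu :> (set T -> \bar R).
Proof.
move=> A0; rewrite /cond_prob; case: pselect => // mA'.
apply/funext => B.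
by rewrite /= /mnormalize /= /mrestr setTI [X in X == 0]A0 eqxx.
Qed.

Lemma cond_prob_sub (A B : set T) : measurable A -> 0 < mu A ->
  measurable B -> B `<=` A ->
  cond_prob mu A B = (fine (mu B) / fine (mu A))%:E.
Proof.
move=> mA A0 mB BA; rewrite cond_probE// setIidl// EFinM fine_prob//.
congr (_ * _); rewrite -[in LHS](fine_prob mu mA) inver ifF//.
by apply/negP => /eqP E; move: A0; rewrite -(fine_prob mu mA) E ltxx.
Qed.

(** Also true in the default cases, A null or not measurable, where [cond_prob mu A] is [mu]; so a
    null nonatomic part needs no separate treatment in the a.e. clauses. *)
Lemma cond_prob_dominates (A : set T) : content_dominates mu (cond_prob mu A).
Proof.
move=> B mB B0; have [mA|nmA] := pselect (measurable A); last first.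
  by rewrite /cond_prob; case: pselect.
have [A0|A0] := eqVneq (mu A) 0; first by rewrite cond_probE0.
rewrite cond_probE//; last by rewrite lt_neqAle eq_sym A0/=.
rewrite [X in X / _](_ : _ = 0) ?mul0e//.
apply: (subset_measure0 _ mB _ B0); [exact: measurableI|exact: subIsetl].
Qed.

Lemma cond_prob_eq0 (A B : set T) : measurable A -> 0 < mu A -> measurable B ->
  cond_prob mu A B = 0 -> mu (B `&` A) = 0.
Proof.
move=> mA A0 mB; rewrite cond_probE// => /eqP.
rewrite mule_eq0 => /orP[/eqP//|]; rewrite inve_eq0 => /eqP Ay.
by have := fine_prob mu mA; rewrite Ay.
Qed.

(** The return direction, from the conditional probability to [mu]: needed to turn a splitting of an
    atom into a cut of the whole space. *)
Lemma ae_prod_cond_prob (A : set T) (P : T * T -> Prop) :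
  measurable A -> 0 < mu A ->
  {ae cond_prob mu A \x cond_prob mu A, forall p, P p} ->
  {ae mu \x mu, forall p : T * T, A p.1 -> A p.2 -> P p}.
Proof.
move=> mA A0 [N [mN N0 PN]].
have mNA : measurable (N `&` (A `*` A)).
  by apply: measurableI => //; exact: measurableX.
exists (N `&` (A `*` A)); split => //; last first.
  by move=> p /= /not_implyP[A1 /not_implyP[A2 nP]]; split => //; exact: PN.
apply/product_measure_eq0P => //.
have [M [mM M0 NM]] := (product_measure_eq0P _ _ mN).1 N0.
have mMA := measurableI _ _ mM mA.
have := ae_notin mMA (cond_prob_eq0 mA A0 mM M0).
apply: filterS => x nM.
have [Ax|nAx] := pselect (A x); last first.
  rewrite -[RHS](@measure0 _ _ _ mu); congr (mu _).
  by apply/seteqP; split => y //; rewrite /xsection/= inE => -[_ []].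
rewrite xsectionI in_xsectionX ?inE//.
apply: cond_prob_eq0 => //; first exact: measurable_xsection.
by apply: contrapT => nx; apply: nM; split => //; exact: NM.
Qed.

End conditional_probabilities.

(** * Components of the kernel *)

Section components.
Context {d : measure_display} {T : measurableType d} {R : realType}
  (mu : probability T R) (W : T -> T -> R)
  (hW : tournament_kernel [set: T] mu W) (h : T -> R) (hh : position mu W h)
  {Q : countType} (S : Q -> set T)
  (hS : atom_enumeration (sigmaZ mu W) mu S) (t : Q -> R) (ht : forall i,
  mu (S i `\` [set x | h x = t i]) = 0 /\ mu ([set x | h x = t i] `\` S i) = 0).

Let mI := measurable_nonatomic hS.
Let mS := measurable_atom hS.

Lemma measure_decomposition (A : set T) : measurable A ->
  mu A = dsum_measure (fun i => mu (S i)) (fun i => cond_prob mu (S i))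
    (cond_prob mu (nonatomic_part S)) A.
Proof.
move=> mA; rewrite /dsum_measure.
have mU := measurable_bigcup_atoms hS setT.
have IE : 1 - \esum_(i in [set: Q]) mu (S i) = mu (nonatomic_part S).
  by rewrite /nonatomic_part probability_setC// (measure_bigcup_atoms hS).
have -> : \esum_(i in [set: Q]) (mu (S i) * cond_prob mu (S i) A) =
    mu (A `&` \bigcup_i S i).
  rewrite setI_bigcupr measure_bigcup_countable.
  - apply: eq_esum => i _; rewrite cond_probE//; last exact: (atom_gt0 hS).
    by rewrite muleCA divee ?mule1// ?fin_num_measure// gt_eqF// (atom_gt0 hS).
  - by move=> i; exact: measurableI.
  - by have [_ tS _] := hS; exact: trivIset_setIl.
rewrite IE (probDI mu mA mU); congr (_ + _).
(* Here the conditional probability has its default value, but its coefficient is 0. *)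
have [I0|I0] := eqVneq (mu (nonatomic_part S)) 0.
  rewrite I0 mul0e; apply: (subset_measure0 _ mI _ I0).
    exact: measurableD.
  by move=> x [].
have Igt0 : 0 < mu (nonatomic_part S) by rewrite lt_neqAle eq_sym I0/=.
by rewrite cond_probE// muleCA divee ?mule1// fin_num_measure.
Qed.

(* Covers both sigma(Z) and the full sigma-algebra. *)
Lemma nonatomic_conditional (G : set (set T)) : 0 < mu (nonatomic_part S) ->
  G `<=` measurable ->
  (forall A E, G A -> sigmaZ mu W E -> G (A `&` E)) ->
  nonatomic G (nonatomic_part S) (cond_prob mu (nonatomic_part S)).
Proof.
move=> I0 Gm GI A AI [GA A0 nA].
have mA := Gm _ GA.
have If0 : (0 < fine (mu (nonatomic_part S)))%R by rewrite -lte_fin fine_prob.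
have mlt := measurable_position_lt hh.
have cE X : measurable X -> X `<=` A ->
    cond_prob mu (nonatomic_part S) X =
    (fine (mu X) / fine (mu (nonatomic_part S)))%:E.
  by move=> mX XA; apply: cond_prob_sub => //; exact: subset_trans AI.
(* If {h < s} cut A into two parts of positive measure, A would not be an atom. So A sits on one
   level, which is null in the nonatomic part. *)
have [|s As] := zero_one_level hh mA.
  move=> s; have mAs := measurableI _ _ mA (mlt s).
  have [|As0] := eqVneq (mu (A `&` [set x | (h x < s)%R])) 0; [by left|right].
  have mAD := measurableD mA (mlt s).
  apply/eqP; apply: contrapT => /negP AD0.
  have fpos X : measurable X -> mu X != 0 -> (0 < fine (mu X))%R.
    by move=> mX X0; rewrite -lte_fin fine_prob// lt_neqAle eq_sym X0/=.
  apply: nA; exists (A `&` [set x | (h x < s)%R]); split.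
  - by apply: GI => //; apply: sigmaZ_cut; exact: (cut_position_lt hh).
  - exact: subIsetl.
  - rewrite (cE A mA (@subset_refl _ A)) (cE _ mAs (@subIsetl _ _ _)).
    rewrite !lte_fin; apply/andP; split; first by rewrite divr_gt0// fpos.
    rewrite ltr_pM2r ?invr_gt0//.
    by rewrite [ltRHS](fine_probDI mu mA (mlt s)) ltrDr fpos.
move: A0; rewrite cE// (_ : mu A = 0) ?mul0r ?ltxx//.
have mL := measurable_position_level hh s.
rewrite (probDI mu mA mL) As add0e.
apply: (subset_measure0 _ _ _ (nonatomic_level hh hS s)).
- exact: measurableI.
- exact: measurableI.
- exact: setSI.
Qed.

Lemma tournament_atom i : tournament_kernel (S i) (cond_prob mu (S i)) W.
Proof.
have [mW W01 Wsym] := hW; split.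
- by apply: measurable_funS mW; rewrite setXTT.
- by move=> x y _ _; exact: W01.
- have dom := @cond_prob_dominates _ _ _ mu (S i).
  apply: (ae_dominates (prod_dominates dom dom)).
  by apply: filterS Wsym => p Wp _ _; exact: Wp.
Qed.

(* If B precedes S i `\` B then {h < t i} `|` B is a cut splitting S i. *)
Lemma irreducible_atom i : irreducible_kernel (S i) (cond_prob mu (S i)) W.
Proof.
move=> [B [mB BS /andP[B0 B1] [_ _ _ WB]]].
have Si0 := atom_gt0 hS i; have Sf0 := fine_atom_gt0 hS i.
have [aS _ _] := hS.
have {}WB := ae_prod_cond_prob (mS i) Si0 WB.
have aeS := ae_atom_position hh hS ht.
have mlt := measurable_position_lt hh (t i).
have cU : cut mu W ([set x | (h x < t i)%R] `|` B).
  split; first exact: measurableU.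
  have aeS2 : {ae mu \x mu, forall p : T * T,
      (S i p.1 <-> h p.1 = t i) /\ (S i p.2 <-> h p.2 = t i)}.
    by apply: filterS2 (ae_prod_fst mu aeS) (ae_prod_snd mu aeS) => p; split.
  apply: filterS3 WB (ae_position_lt_W1 hh) aeS2.
  move=> [x y] /= WBp Wlt [xS yS] Ux nUy.
  have [hy|hy] := eqVneq (h y) (t i).
    case: Ux => [hx|Bx]; first by apply: Wlt; rewrite hy.
    apply: WBp => //; [exact: BS|exact/yS|split; first exact/yS].
    by move=> By; apply: nUy; right.
  have ty : (t i < h y)%R.
    by rewrite lt_neqAle eq_sym hy leNgt; apply/negP => ?; apply: nUy; left.
  apply: Wlt; case: Ux => [hx|Bx]; first exact: lt_trans ty.
  by rewrite (xS.1 (BS _ Bx)).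
have UB : mu (S i `&` ([set x | (h x < t i)%R] `|` B)) = mu B.
  apply: ae_measure_eq => //.
    by apply: measurableI => //; exact: measurableU.
  apply: filterS aeS => x xS; split => [[Sx [/= +|//]]|Bx].
    by rewrite ((xS i).1 Sx) ltxx.
  by split; [exact: BS|right].
have UD : mu (S i `\` ([set x | (h x < t i)%R] `|` B)) = mu (S i `\` B).
  apply: ae_measure_eq.
  - by apply: measurableD => //; exact: measurableU.
  - exact: measurableD.
  apply: filterS aeS => x xS; split => [[Sx nU]|[Sx nB]]; split => //.
    by move=> Bx; apply: nU; right.
  by case=> //=; rewrite ((xS i).1 Sx) ltxx.
move: B0 B1; rewrite cond_prob_sub// lte_fin lte_fin ltr_pdivrMr// mul1r.
move=> B0 B1.
have := fine_probDI mu (mS i) mB; rewrite setIidr// => SB.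
(* On S_i this cut is a.e. B, so B or its complement in S_i would be null, against 0 < mu B <
   mu(S_i). *)
have := atom_zero_one (aS i) (sigmaZ_cut cU).
rewrite UB UD => -[] E; move: B0 B1 SB; rewrite E /=.
- by rewrite mul0r ltxx.
- by rewrite add0r => _ lt Eq; move: lt; rewrite Eq ltxx.
Qed.

(** On the nonatomic part W x y > 0 forces h x < h y a.e., and h x < h z forces W x z = 1;
    transitivity is that of the order on R. *)
Lemma transitive_nonatomic (nu : probability T R) (A : set T) :
  content_dominates mu nu -> A `<=` nonatomic_part S ->
  transitive_kernel A nu W.
Proof.
move=> dom AI.
have ae_lt : {ae nu \x nu, forall p : T * T, A p.1 -> A p.2 ->
    (0 < W p.1 p.2)%R -> (h p.1 < h p.2)%R}.
  apply: (ae_dominates (prod_dominates dom dom)).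
  apply: filterS2 (ae_position_gt_W0 hW hh) (ae_nonatomic_pair_neq hh hS).
  move=> p W0 neq /AI I1 /AI I2.
  have [//|/W0 ->|/(neq I1 I2)//] := ltgtP (h p.1) (h p.2).
  by rewrite ltxx.
have ae_W1 : {ae nu \x nu, forall p : T * T,
    (h p.1 < h p.2)%R -> W p.1 p.2 = 1%R}.
  exact: (ae_dominates (prod_dominates dom dom) (ae_position_lt_W1 hh)).
have ae12 := ae_prod_fst nu ae_lt.
have ae23 := ae_prod_comp_fst measurable_snd
  (@ae_prod_snd _ _ _ _ _ nu nu) ae_lt.
have ae13 := ae_prod_comp_fst measurable_fst
  (@ae_prod_fst _ _ _ _ _ nu nu) ae_W1.
apply: filterS3 ae12 ae23 ae13 => -[[x y] z] /= hxy hyz hxz Ax Ay Az Wxy Wyz.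
by apply: hxz; apply: lt_trans (hxy _ _ _) (hyz _ _ _).
Qed.

End components.

Theorem theorem6p11 (d : measure_display) (T : measurableType d) (R : realType)
    (mu : probability T R) (W : T -> T -> R)
    (hW : tournament_kernel [set: T] mu W)
    (Q : countType) (S : Q -> set T)
    (hS : atom_enumeration (sigmaZ mu W) mu S) :
  let I := nonatomic_part S in
  let eta := eta_map mu W S in
  let mu_ := fun i : Q => cond_prob mu (S i) in
  let muI := cond_prob mu I in
  (* S is the disjoint union of I and the S_i *)
  [/\ trivIset [set: Q] S, forall i, I `&` S i = set0 &
      [set: T] = I `|` \bigcup_i S i] /\
  (* decomposition of mu *)
  (forall A, measurable A ->
     mu A = dsum_measure (fun i => mu (S i)) mu_ muI A) /\
  (* W is the direct sum, with eta taking its values in [0, 1] *)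
  [/\ forall i, (0 <= eta (inl i) <= 1)%R,
      forall x, I x -> (0 <= eta (inr x) <= 1)%R &
      {ae mu \x mu, forall p : T * T,
         W p.1 p.2 = dsum_kernel S (fun=> W) eta p.1 p.2}] /\
  (* (i) *)
  (forall i, 0 < mu (S i)) /\
  (* (ii) *)
  (forall i A, measurable A -> mu_ i A = mu (A `&` S i) / mu (S i)) /\
  (* (iii) *)
  (0 < mu I ->
     [/\ forall A, measurable A -> muI A = mu (A `&` I) / mu I,
         nonatomic measurable I muI & nonatomic (sigmaZ mu W) I muI]) /\
  (* (iv) *)
  [/\ injective (fun i => eta (inl i)),
      {ae muI \x muI, forall p : T * T, I p.1 -> I p.2 ->
         eta (inr p.1) = eta (inr p.2) -> p.1 = p.2} &
      {ae muI, forall x, I x ->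
         (0 <= eta (inr x) <= 1)%R /\
         forall i, ~ (eta (inl i) <= eta (inr x)
                        < eta (inl i) + fine (mu (S i)))%R}] /\
  (* (v) *)
  (forall i, tournament_kernel (S i) (mu_ i) W
             /\ irreducible_kernel (S i) (mu_ i) W) /\
  (* (vi) *)
  (forall A, measurable A -> A `<=` I -> 0 < muI A ->
     transitive_kernel A (cond_prob muI A) W).
Proof.
move=> I eta mu_ muI.
have [h hh] := exists_position hW.
have [t ht] := exists_atom_position hh hS.
have mI : measurable I := measurable_nonatomic hS.
have mS := measurable_atom hS.
have domI : content_dominates mu muI := @cond_prob_dominates _ _ _ mu I.
split; [split|split; [|split; [split|split; [|split; [|split; [|split;
  [split|split]]]]]]].
- by have [] := hS.
- move=> i; apply/seteqP; split => x // [Ix Sx].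
  exact: (nonatomic_partN Ix Sx).
- by rewrite /I /nonatomic_part setvU.
- by move=> A mA; exact: (measure_decomposition hS).
- by move=> i; exact: (eta_inl_bounds hW hS hh ht).
- by move=> x _; exact: (eta_inr_bounds hW hS).
- exact: (ae_kernel_eq hW hS hh ht).
- exact: (atom_gt0 hS).
- by move=> i A mA; rewrite /mu_ cond_probE//; exact: (atom_gt0 hS).
- move=> I0; split; first by move=> A mA; rewrite /muI cond_probE.
  + apply: (nonatomic_conditional hh hS I0) => // A E mA /sigmaZ_measurable mE.
    exact: measurableI.
  + apply: (nonatomic_conditional hh hS I0) => [A /sigmaZ_measurable//|A E].
    exact: sigmaZ_setI.
- exact: (eta_inl_inj hW hS hh ht).
- apply: (ae_dominates (prod_dominates domI domI)).
  have ae_eta := ae_eta_inr hW hS hh ht.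
  apply: filterS3 (ae_nonatomic_pair_neq hh hS) (ae_prod_fst mu ae_eta)
    (ae_prod_snd mu ae_eta) => p neq e1 e2 I1 I2.
  by rewrite /eta e1 e2 => /(neq I1 I2).
- apply: (ae_dominates domI); apply: filterS (ae_eta_avoid hW hS hh ht).
  by move=> x avoid Ix; split; [exact: (eta_inr_bounds hW hS)|exact: avoid].
- move=> i; split; first exact: (tournament_atom hW).
  exact: (irreducible_atom hh hS ht).
- move=> A mA AI _; apply: (transitive_nonatomic hW hh hS) => // B mB B0.
  (* Conditioning twice: null sets pass from [mu] to [muI], then to its conditional on [A]. *)
  by apply: (@cond_prob_dominates _ _ _ muI A) => //; exact: domI.
Qed.
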